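(* Let $\hat\Theta=\Theta\wedge\epsilon\in\Lambda^6\mathbb{R}^{10}$ be the lift to ten dimensions of the $\mathfrak{spin}(7)$-invariant four-form $\Theta$ on $\mathbb{R}^8$, where $\epsilon$ is the volume form of $\mathbb{R}^2\subset\mathbb{R}^{10}=\mathbb{R}^8\oplus\mathbb{R}^2$. With respect to the decomposition $$\Lambda^3\mathbb{R}^{10}=\Lambda^3\mathbb{R}^8\ \oplus\ \Lambda^2\mathbb{R}^8\otimes\mathbb{R}^2\ \oplus\ \mathbb{R}^8\otimes\Lambda^2\mathbb{R}^2$$ the operator $b_{\hat\Theta}:\Lambda^3\mathbb{R}^{10}\to\Lambda^3\mathbb{R}^{10}$ is given by $$b_{\hat\Theta}=\begin{pmatrix}0&0&6\,\tilde e_\Theta\otimes *\\ 0&-3\,b_\Theta\otimes *&0\\ e_\Theta\otimes *&0&0\end{pmatrix}.$$ Its eigenvalues, eigenspaces and their dimensions are as follows, where upper and lower signs correspond: - $0$: $\ \Lambda^3_{(\frac23)}\mathbb{R}^8$, of dimension $48$; - $\pm18i$: $\ \Lambda^2_{(-6)}\mathbb{R}^8\otimes\mathbb{R}_\pm$, of dimension $7$ each; - $\pm6i$: $\ \Lambda^2_{(2)}\mathbb{R}^8\otimes\mathbb{R}_\mp$, of dimension $21$ each; - $\pm6\sqrt7\,i$: $\ \big\{\big(\mp\frac{i}{\sqrt7}\,\tilde e_\Theta(F),\,F\wedge\epsilon\big)\,:\,F\in\mathbb{R}^8\big\}$, of dimension $8$ each. Here a pair $(x,F\wedge\epsilon)$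 lies in $\Lambda^3\mathbb{R}^8\oplus\mathbb{R}^8\otimes\Lambda^2\mathbb{R}^2$.
   Context: Euclidean $\mathbb{R}^{10}=\mathbb{R}^8\oplus\mathbb{R}^2$ has orthonormal basis $e_1,\ldots,e_{10}$, with $\mathbb{R}^8=\mathrm{span}\{e_1,\ldots,e_8\}$, $\mathbb{R}^2=\mathrm{span}\{e_9,e_{10}\}$, $\epsilon=e_9\wedge e_{10}$. Indices are raised with the metric, repeated indices are summed, and square brackets denote weight-one antisymmetrization. $\Theta\in\Lambda^4\mathbb{R}^8$ has totally antisymmetric components determined by $\Theta_{ijkl}=1$ for $(ijkl)=(1245),(1276),(1346),(1357),(2356),(2437),(4567),(1238),(4358),(4718),(5168),(5728),(6248),(6738)$, all components with index sets not listed being zero; it is invariant under $\mathfrak{spin}(7)\subset\mathfrak{so}(8)$. For a $2m$-form $\Omega$, the duality operator $b_\Omega$ on $k$-forms is the projection of $\Omega\otimes F$ to $\Lambda^k$, taken up to a constant factor; in components $b_\Omega(F)_{i_1\ldots i_k}=\Omega_{j_1\ldots j_m[i_1\ldots i_m}F^{j_1\ldots j_m}{}_{i_{m+1}\ldots i_k]}$. Thus on ten-dimensional three-forms $b_{\hat\Theta}(F)_{lmn}=\hat\Theta_{ijklmn}F^{ijk}$, and on $\mathbb{R}^8$: $b_\Theta(F)_{ij}=\Theta_{klij}F^{kl}$ on $\Lambda^2$ and $b_\Theta(F)_{lmn}=\Theta_{ij[lm}F^{ij}{}_{n]}$ on $\Lambda^3$. $\Lambda^k_{(\beta)}\mathbb{R}^8$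 is the $\beta$-eigenspace of $b_\Theta$ on $\Lambda^k\mathbb{R}^8$. Further, $e_\Theta:\Lambda^3\mathbb{R}^8\to\mathbb{R}^8$, $e_\Theta(F)_l=\Theta_{ijkl}F^{ijk}$, and $\tilde e_\Theta:\mathbb{R}^8\to\Lambda^3\mathbb{R}^8$, $\tilde e_\Theta(F)_{jkl}=\Theta_{ijkl}F^i$. The second tensor factor $*$ is the Hodge operator of $\mathbb{R}^2$, acting on $\Lambda^q\mathbb{R}^2$. Elements $F\otimes V$ with $F\in\Lambda^{p}\mathbb{R}^8$, $V\in\Lambda^q\mathbb{R}^2$ are identified with $F\wedge V$; the matrix acts on column vectors of the three summands in the order written. $\mathbb{R}_\pm$ denotes the $\pm i$-eigenspace of $*$ on (the complexified) $\mathbb{R}^2$; the eigenspaces in the claim are understood in the complexification. *)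

(* Defs.v *)
From HB Require Import structures.
From mathcomp Require Import all_boot all_order all_fingroup all_algebra.
From mathcomp Require Import complex reals.

Set Implicit Arguments.
Unset Strict Implicit.
Unset Printing Implicit Defensive.

Import Order.TTheory GRing.Theory Num.Theory passmx.
Local Open Scope ring_scope.

(* Rank-k tensors on K^n, given by their components in the standard basis. A
   multi-index (i_1 ... i_k) is a row vector of indices, so that row_mx
   concatenates, lsubmx/rsubmx split and col_perm permutes multi-indices.
   Indices start at 0: the basis vector e_a is indexed by a - 1. The metric is
   the standard one, so upper and lower indices need not be distinguished. *)
Notation tensor K n k := {ffun 'rV['I_n]_k -> K^o}.

Section Forms.
Variables (K : fieldType) (n : nat).

Definition permute k (s : 'S_k) (F : tensor K n k) : tensor K n k :=
  [ffun t => F (col_perm s t)].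

Fact permute_is_linear k (s : 'S_k) : linear (permute s).
Proof. by move=> a F G; apply/ffunP=> t; rewrite !ffunE. Qed.
HB.instance Definition _ k (s : 'S_k) :=
  GRing.isLinear.Build K (tensor K n k) (tensor K n k) _ (permute s)
    (permute_is_linear s).

(* The k-forms on K^n, as the totally antisymmetric tensors. *)
Definition Lambda k : {vspace tensor K n k} :=
  (\bigcap_(s : 'S_k) leigenspace (linfun (permute s)) ((-1) ^+ s))%VS.

Lemma LambdaP k (F : tensor K n k) :
  reflect (forall (s : 'S_k) t, F (col_perm s t) = (-1) ^+ s * F t)
          (F \in Lambda k).
Proof.
have eigP s : reflect (permute s F = (-1) ^+ s *: F)
    (F \in leigenspace (linfun (permute s)) ((-1) ^+ s)).
  rewrite memv_ker add_lfunE opp_lfunE scale_lfunE !lfunE /= subr_eq0.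
  exact: eqP.
apply: (iffP idP) => [FL s t | FA].
  suff /eigP/ffunP/(_ t) : F \in leigenspace (linfun (permute s)) ((-1) ^+ s).
    by rewrite !ffunE.
  by apply: subvP FL; rewrite /Lambda (bigD1 s) //= capvSl.
rewrite memvE; apply/subv_bigcapP => s _; rewrite -memvE; apply/eigP/ffunP=> t.
by rewrite !ffunE FA.
Qed.

Definition alt k (F : tensor K n k) : tensor K n k :=
  [ffun t => k`!%:R^-1 * \sum_(s : 'S_k) (-1) ^+ s * F (col_perm s t)].

Fact alt_is_linear k : linear (@alt k).
Proof.
move=> a F G; apply/ffunP=> t; rewrite !ffunE.
under eq_bigr do rewrite !ffunE mulrDr [_ * (_ *: _)]mulrCA.
by rewrite big_split /= -mulr_sumr mulrDr mulrCA.
Qed.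
HB.instance Definition _ k :=
  GRing.isLinear.Build K (tensor K n k) (tensor K n k) _ (@alt k)
    (@alt_is_linear k).

Lemma alt_Lambda k (F : tensor K n k) : alt F \in Lambda k.
Proof.
apply/LambdaP=> s t; rewrite !ffunE mulrCA; congr (_ * _).
rewrite mulr_sumr (reindex_inj (mulIg s^-1%g)) /=; apply: eq_bigr => u _.
rewrite mulrA -signr_addb; congr (_ ^+ _ * _).
  by rewrite odd_permM odd_permV addbC.
by congr (F _); apply/rowP=> j; rewrite !mxE permM permKV.
Qed.

Definition delta k (t : 'rV['I_n]_k) : tensor K n k :=
  [ffun u => (u == t)%:R].

Definition basis_form (i : 'I_n) : tensor K n 1 := delta (const_mx i).

(* Normalized so that e_{i_1} /\ ... /\ e_{i_k} has component 1 at
   (i_1 ... i_k) when the indices are distinct. *)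
Definition wedge p q (F : tensor K n p) (G : tensor K n q) :
    tensor K n (p + q) :=
  'C(p + q, p)%:R *: alt [ffun t => F (lsubmx t) * G (rsubmx t)].

(* The operator b_Omega on k-forms, where Omega has degree 2m and k = m + r:
   b_Omega(F)_{i_1...i_k}
     = Omega_{j_1...j_m [i_1...i_m} F^{j_1...j_m}_{i_{m+1}...i_k]}. *)
Definition duality m r (Omega : tensor K n (m + m)) (F : tensor K n (m + r)) :
    tensor K n (m + r) :=
  alt [ffun t => \sum_(j : 'rV['I_n]_m)
                   Omega (row_mx j (lsubmx t)) * F (row_mx j (rsubmx t))].

Fact duality_is_linear m r Omega : linear (@duality m r Omega).
Proof.
move=> a F G; rewrite /duality -linearP /=; congr alt; apply/ffunP=> t.
rewrite !ffunE scaler_sumr -big_split /=; apply: eq_bigr => j _.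
by rewrite !ffunE mulrDr [_ * (_ *: _)]mulrCA.
Qed.
HB.instance Definition _ m r Omega :=
  GRing.isLinear.Build K (tensor K n (m + r)) (tensor K n (m + r)) _
    (@duality m r Omega) (@duality_is_linear m r Omega).

Lemma duality_Lambda m r Omega F : @duality m r Omega F \in Lambda (m + r).
Proof. exact: alt_Lambda. Qed.

(* The eigenspace of an operator on k-forms. *)
Definition form_eigenspace k (f : tensor K n k -> tensor K n k) (a : K) :
    {vspace tensor K n k} :=
  (Lambda k :&: leigenspace (linfun f) a)%VS.

(* ( * V)_{a_1...a_p} = 1/q! vol_{a_1...a_p b_1...b_q} V^{b_1...b_q}. *)
Definition hodge p q (vol : tensor K n (p + q)) (V : tensor K n q) :
    tensor K n p :=
  [ffun a => q`!%:R^-1 * \sum_(b : 'rV['I_n]_q) vol (row_mx a b) * V b].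

Fact hodge_is_linear p q vol : linear (@hodge p q vol).
Proof.
move=> a F G; apply/ffunP=> t; rewrite !ffunE.
under eq_bigr do rewrite !ffunE mulrDr [_ * (_ *: _)]mulrCA.
by rewrite big_split /= -mulr_sumr mulrDr mulrCA.
Qed.
HB.instance Definition _ p q vol :=
  GRing.isLinear.Build K (tensor K n q) (tensor K n p) _
    (@hodge p q vol) (@hodge_is_linear p q vol).

End Forms.

Arguments Lambda K n k : clear implicits.

(* Extension of a tensor along the inclusion of coordinate subspaces which sends
   the i-th basis vector to the f(i)-th one. *)
Definition push (K : fieldType) n N k (f : 'I_n -> 'I_N) (F : tensor K n k) :
    tensor K N k :=
  [ffun t => \sum_(s : 'rV['I_n]_k | map_mx f s == t) F s].

Fact push_is_linear (K : fieldType) n N k f : linear (@push K n N k f).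
Proof.
move=> a F G; apply/ffunP=> t; rewrite !ffunE scaler_sumr -big_split /=.
by apply: eq_bigr => s _; rewrite !ffunE.
Qed.
HB.instance Definition _ (K : fieldType) n N k f :=
  GRing.isLinear.Build K (tensor K n k) (tensor K N k) _ (@push K n N k f)
    (@push_is_linear K n N k f).

(* The tensor product of K^I and K^J is K^(I * J). *)
Section TensorProduct.
Variable K : fieldType.

Definition otimes (I J : finType) (F : {ffun I -> K^o}) (G : {ffun J -> K^o}) :
    {ffun I * J -> K^o} :=
  [ffun x => F x.1 * G x.2].

Definition otimesv (I J : finType) (U : {vspace {ffun I -> K^o}})
    (V : {vspace {ffun J -> K^o}}) : {vspace {ffun I * J -> K^o}} :=
  <<[seq otimes F G | F <- vbasis U, G <- vbasis V]>>%VS.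

(* For linear A and B, the linear map with F (x) G |-> A F (x) B G: apply B in
   the second variable, then A in the first one. *)
Definition otimes_map (I J I' J' : finType)
    (A : {ffun I -> K^o} -> {ffun I' -> K^o})
    (B : {ffun J -> K^o} -> {ffun J' -> K^o}) (T : {ffun I * J -> K^o}) :
    {ffun I' * J' -> K^o} :=
  [ffun y => A [ffun i => B [ffun j => T (i, j)] y.2] y.1].

End TensorProduct.

Notation bitensor K p q := {ffun 'rV['I_8]_p * 'rV['I_2]_q -> K^o}.

Section Spin7.
Variable K : fieldType.

Definition incl8 k : tensor K 8 k -> tensor K (8 + 2) k := push (@lshift 8 2).
Definition incl2 k : tensor K 2 k -> tensor K (8 + 2) k := push (@rshift 8 2).
HB.instance Definition _ k := GRing.Linear.on (@incl8 k).
HB.instance Definition _ k := GRing.Linear.on (@incl2 k).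

(* The identification of F (x) V with F /\ V, extended linearly. *)
Definition to_wedge p q (T : bitensor K p q) : tensor K (8 + 2) (p + q) :=
  \sum_s \sum_u T (s, u) *: wedge (incl8 (delta K s)) (incl2 (delta K u)).

Fact to_wedge_is_linear p q : linear (@to_wedge p q).
Proof.
move=> a F G; rewrite /to_wedge scaler_sumr -big_split /=.
apply: eq_bigr => s _; rewrite scaler_sumr -big_split /=.
by apply: eq_bigr => u _; rewrite !ffunE scalerDl ?scalerA.
Qed.
HB.instance Definition _ p q :=
  GRing.isLinear.Build K (bitensor K p q) (tensor K (8 + 2) (p + q)) _
    (@to_wedge p q) (@to_wedge_is_linear p q).

(* The listed components Theta_{ijkl} = 1, with indices starting at 1. *)
Definition Theta_table : seq (seq nat) :=
  [:: [:: 1; 2; 4; 5]; [:: 1; 2; 7; 6]; [:: 1; 3; 4; 6]; [:: 1; 3; 5; 7];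
      [:: 2; 3; 5; 6]; [:: 2; 4; 3; 7]; [:: 4; 5; 6; 7]; [:: 1; 2; 3; 8];
      [:: 4; 3; 5; 8]; [:: 4; 7; 1; 8]; [:: 5; 1; 6; 8]; [:: 5; 7; 2; 8];
      [:: 6; 2; 4; 8]; [:: 6; 7; 3; 8]]%N.

Definition Theta_index (q : seq nat) : 'rV['I_8]_4 :=
  \row_(j < 4) inord (nth 0%N q j).-1.

Definition Theta : tensor K 8 4 :=
  [ffun t => \sum_(q <- Theta_table) \sum_(s : 'S_4)
               (-1) ^+ s * (t == col_perm s (Theta_index q))%:R].

(* e_9 /\ e_10, as a two-form on the plane. *)
Definition epsilon : tensor K 2 2 :=
  wedge (basis_form K (0 : 'I_2)) (basis_form K (1 : 'I_2)).

Definition Theta_hat : tensor K (8 + 2) 6 :=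
  wedge (incl8 Theta) (incl2 epsilon).

Definition b_Theta2 : tensor K 8 2 -> tensor K 8 2 := @duality K 8 2 0 Theta.
Definition b_Theta3 : tensor K 8 3 -> tensor K 8 3 := @duality K 8 2 1 Theta.
Definition b_Theta_hat : tensor K (8 + 2) 3 -> tensor K (8 + 2) 3 :=
  @duality K (8 + 2) 3 0 Theta_hat.

Definition e_Theta (F : tensor K 8 3) : tensor K 8 1 :=
  [ffun l => \sum_(t : 'rV['I_8]_3) Theta (row_mx t l : 'rV_(3 + 1)) * F t].
Definition et_Theta (F : tensor K 8 1) : tensor K 8 3 :=
  [ffun t => \sum_(i : 'rV['I_8]_1) Theta (row_mx i t : 'rV_(1 + 3)) * F i].

(* In the plane: * 1 = e_9 /\ e_10, * (e_9 /\ e_10) = 1, and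
   ( * V)_a = epsilon_{ab} V^b on one-forms, i.e. * e_9 = - e_10 and
   * e_10 = e_9. *)
Definition star0 : tensor K 2 0 -> tensor K 2 2 := @hodge K 2 2 0 epsilon.
Definition star1 : tensor K 2 1 -> tensor K 2 1 := @hodge K 2 1 1 epsilon.
Definition star2 : tensor K 2 2 -> tensor K 2 0 := @hodge K 2 0 2 epsilon.

Fact b_Theta2_is_linear : linear b_Theta2.
Proof. exact: (@duality_is_linear K 8 2 0 Theta). Qed.
HB.instance Definition _ :=
  GRing.isLinear.Build K (tensor K 8 2) (tensor K 8 2) _ b_Theta2
    b_Theta2_is_linear.
Fact b_Theta3_is_linear : linear b_Theta3.
Proof. exact: (@duality_is_linear K 8 2 1 Theta). Qed.
HB.instance Definition _ :=
  GRing.isLinear.Build K (tensor K 8 3) (tensor K 8 3) _ b_Theta3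
    b_Theta3_is_linear.
Fact b_Theta_hat_is_linear : linear b_Theta_hat.
Proof. exact: (@duality_is_linear K (8 + 2) 3 0 Theta_hat). Qed.
HB.instance Definition _ :=
  GRing.isLinear.Build K (tensor K (8 + 2) 3) (tensor K (8 + 2) 3) _ b_Theta_hat
    b_Theta_hat_is_linear.
Fact star1_is_linear : linear star1.
Proof. exact: (@hodge_is_linear K 2 1 1 epsilon). Qed.
HB.instance Definition _ :=
  GRing.isLinear.Build K (tensor K 2 1) (tensor K 2 1) _ star1
    star1_is_linear.

Definition triple : Type :=
  (bitensor K 3 0 * bitensor K 2 1 * bitensor K 1 2)%type.

Definition LambdaLambda p q : {vspace bitensor K p q} :=
  otimesv (Lambda K 8 p) (Lambda K 2 q).

Definition in_summands (x : triple) : Prop :=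
  let: (x1, x2, x3) := x in
  [/\ x1 \in LambdaLambda 3 0, x2 \in LambdaLambda 2 1
    & x3 \in LambdaLambda 1 2].

Definition assemble (x : triple) : tensor K (8 + 2) 3 :=
  let: (x1, x2, x3) := x in
  (to_wedge x1 : tensor K (8 + 2) 3) + to_wedge x2 + to_wedge x3.

(* The 3 x 3 block matrix, acting on column vectors. *)
Definition block_operator (x : triple) : triple :=
  let: (x1, x2, x3) := x in
  (6%:R *: otimes_map et_Theta star2 x3,
   - 3%:R *: otimes_map b_Theta2 star1 x2,
   otimes_map e_Theta star0 x1).

End Spin7.

(* Main.v *)
(* A three-form F on R^10 has three kinds of components, A = (F_{abc}),
   B_c = (F_{ab c}) with c = 9, 10, and D = (F_{a 9 10}), where a, b, c <= 8
   otherwise; contraction with Theta /\ epsilon turns them into 6 et_Theta(D),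
   -3 b_Theta( * B) and e_Theta(A). Everything then follows from three
   contraction identities of Theta, which are finite integer computations:
   e et = -42, b^2 = 12 - 4 b on two-forms and b = 2/3 + (et e)/9 on
   three-forms. If F is an eigenvector, B_9 + t B_10 with t = i or -i is zero or
   an eigenvector of b_Theta, while on D the square of the operator is
   6 e et = -252. The dimensions 7 and 21 come from dim Lambda^2 = 28: a two-form
   in the eigenspace of -6 is determined by its seven components F_{a8}, one in
   the eigenspace of 2 by the other 21. *)

Require Import Defs.
From HB Require Import structures.
From mathcomp Require Import all_boot all_order all_fingroup all_algebra.
From mathcomp Require Import complex reals.
From mathcomp Require Import ring zify.

Set Implicit Arguments.
Unset Strict Implicit.
Unset Printing Implicit Defensive.

Import Order.TTheory GRing.Theory Num.Theory.
Local Open Scope ring_scope.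

(** * Multi-indices *)

(** No step before the final theorem uses the real or complex numbers: the lemmas hold over any
    [numFieldType], with square roots of -1 and 7 given as elements with prescribed squares. The
    block form is then read over the reals, the spectrum over their complexification. The obstacle
    is that forms are functions on row vectors of indices, and sums over these do not evaluate in
    practice. Multi-indices are therefore built by a cons, which turns such sums into nested sums
    over single indices, and the components of [Theta] are matched with a table of integers on which
    [vm_compute] decides the contractions. The coefficients of the block form count orderings: a
    mixed contraction of three indices has 3 arrangements, and contracting both plane indices with
    the volume form doubles this to 6. With the eigenvalues -6 and 2 of b on two-forms this yields
    18 = 3 * 6 and 6 = 3 * 2; the opposite signs of -6 and 2 are why the eigenspaces for 18 i and 6
    i carry opposite eigenlines of the plane rotation. *)

Definition vnil n : 'rV['I_n]_0 :=
  \row_(j < 0) False_rect 'I_n (notF (ltn_ord j)).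
Arguments vnil {n}.

Definition vcons n k (a : 'I_n) (t : 'rV['I_n]_k) : 'rV['I_n]_k.+1 :=
  \row_(j < k.+1) if unlift ord0 j is Some i then t 0 i else a.

Local Notation "a ::: t" := (vcons a t) (at level 60, right associativity).
Local Notation idx1 a := (a ::: vnil).
Local Notation idx2 a b := (a ::: b ::: vnil).
Local Notation idx3 a b c := (a ::: b ::: c ::: vnil).

Local Notation lo := (lshift 2 : 'I_8 -> 'I_(8 + 2)).
Local Notation hi := (@rshift 8 2 : 'I_2 -> 'I_(8 + 2)).

Section MultiIndices.
Variable n : nat.

Lemma vcons0 k a (t : 'rV['I_n]_k) : (a ::: t) 0 0 = a.
Proof. by rewrite mxE unlift_none. Qed.

Lemma vcons_lift k a (t : 'rV['I_n]_k) i : (a ::: t) 0 (lift 0 i) = t 0 i.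
Proof. by rewrite mxE liftK. Qed.

Definition vconsE := (vcons0, vcons_lift).

Lemma row0_eq (s t : 'rV['I_n]_0) : s = t.
Proof. by apply/rowP=> -[]. Qed.

Lemma vconsP k (t : 'rV['I_n]_k.+1) : t = t 0 0 ::: \row_i t 0 (lift 0 i).
Proof.
by apply/rowP=> i; case: (unliftP 0 i) => [j|] ->; rewrite vconsE ?mxE.
Qed.

(** The two sides have convertible types, since [p.+1 + q] computes to [(p + q).+1]; positions are
    identified through their values as natural numbers. *)
Lemma row_mx_vcons p q a (s : 'rV['I_n]_p) (u : 'rV['I_n]_q) :
  row_mx (a ::: s) u = (a ::: row_mx s u : 'rV['I_n]_(p.+1 + q)).
Proof.
apply/rowP=> i; case: (unliftP (0 : 'I_(p + q).+1) i) => [j|] ->.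
  rewrite vcons_lift; case: (splitP j) => k jk.
    have ->: j = lshift q k by apply: val_inj.
    rewrite row_mxEl -(vcons_lift a s) -[RHS](row_mxEl (a ::: s) u).
    by congr (row_mx _ _ _ _); apply: val_inj.
  have ->: j = rshift p k by apply: val_inj.
  rewrite row_mxEr -[RHS](row_mxEr (a ::: s) u).
  by congr (row_mx _ _ _ _); apply: val_inj.
rewrite vcons0 -[RHS](vcons0 a s) -[RHS](row_mxEl (a ::: s) u).
by congr (row_mx _ _ _ _); apply: val_inj.
Qed.

Lemma row_mx_nil q (s : 'rV['I_n]_0) (u : 'rV['I_n]_q) : row_mx s u = u :> 'rV['I_n]_q.
Proof.
by apply/rowP=> i; rewrite -[RHS](row_mxEr s u); congr (row_mx _ _ _ _); apply: val_inj.
Qed.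

Lemma const_vcons (a : 'I_n) : const_mx a = a ::: vnil :> 'rV['I_n]_1.
Proof. by apply/rowP=> i; rewrite ord1 vcons0 mxE. Qed.

Lemma sum_vnil (M : nmodType) (f : 'rV['I_n]_0 -> M) : \sum_t f t = f vnil.
Proof.
by rewrite (bigD1 vnil) //= big1 ?addr0 // => t /eqP[]; apply: row0_eq.
Qed.

Lemma sum_vcons (M : nmodType) k (f : 'rV['I_n]_k.+1 -> M) :
  \sum_t f t = \sum_a \sum_t f (a ::: t).
Proof.
rewrite pair_big (reindex (fun x : 'I_n * 'rV['I_n]_k => x.1 ::: x.2)) //=.
exists (fun t => (t 0 0, \row_i t 0 (lift 0 i))) => [[a s]|t] _ /=.
  by rewrite vcons0; congr (_, _); apply/rowP=> i; rewrite mxE vcons_lift.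
by rewrite -vconsP.
Qed.

End MultiIndices.
Lemma map_vcons n m (f : 'I_n -> 'I_m) k a (t : 'rV_k) :
  map_mx f (a ::: t) = f a ::: map_mx f t.
Proof.
by apply/rowP=> i; case: (unliftP 0 i) => [j|] ->; rewrite mxE !vconsE ?mxE.
Qed.

Lemma map_vnil n m (f : 'I_n -> 'I_m) t : map_mx f t = vnil.
Proof. exact: row0_eq. Qed.

Lemma fact_neq0 (K : numFieldType) m : m`!%:R != 0 :> K.
Proof. by rewrite pnatr_eq0 -lt0n fact_gt0. Qed.

(** * Forms *)

Section FormsTheory.
Variables (K : numFieldType) (n : nat).
Implicit Types k : nat.

Lemma form_perm k (F : tensor K n k) : F \in Lambda K n k ->
  forall (s : 'S_k) t, F (col_perm s t) = (-1) ^+ s * F t.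
Proof. by move/LambdaP. Qed.

Lemma form_swap0 k (F : tensor K n k.+2) a b t : F \in Lambda K n k.+2 ->
  F (a ::: b ::: t) = - F (b ::: a ::: t).
Proof.
move=> FL; pose s : 'S_k.+2 := tperm 0 (lift 0 0).
have ->: a ::: b ::: t = col_perm s (b ::: a ::: t).
  apply/rowP=> i; rewrite [RHS]mxE /s; case: (unliftP 0 i) => [j|] ->.
    case: (unliftP 0 j) => [l|] ->; first by rewrite tpermD ?vconsE.
    by rewrite tpermR !vconsE.
  by rewrite tpermL !vconsE.
by rewrite (form_perm FL) odd_tperm mulN1r.
Qed.

Definition slice k (F : tensor K n k.+1) a : tensor K n k := [ffun t => F (a ::: t)].

(** A permutation [s] of the remaining indices extends to [lift_perm 0 0 s], which fixes the first
    position and has the same sign. Freezing leading indices thus transports a swap to any depth. *)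
Lemma slice_form k (F : tensor K n k.+1) a :
  F \in Lambda K n k.+1 -> slice F a \in Lambda K n k.
Proof.
move=> FL; apply/LambdaP=> s t; rewrite !ffunE.
have ->: a ::: col_perm s t = col_perm (lift_perm 0 0 s) (a ::: t).
  apply/rowP=> i; rewrite [RHS]mxE; case: (unliftP 0 i) => [j|] ->.
    by rewrite lift_perm_lift !vconsE mxE.
  by rewrite lift_perm_id !vconsE.
by rewrite (form_perm FL) odd_lift_perm.
Qed.

Lemma form_swap1 k (F : tensor K n k.+3) a b c t : F \in Lambda K n k.+3 ->
  F (c ::: a ::: b ::: t) = - F (c ::: b ::: a ::: t).
Proof. by move/(slice_form c)/form_swap0=> /(_ a b t); rewrite !ffunE. Qed.

Lemma row_slice_form p q (F : tensor K n (p + q)) (s : 'rV_p) :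
  F \in Lambda K n (p + q) -> [ffun u => F (row_mx s u)] \in Lambda K n q.
Proof.
elim: p F s => [|p IH] F s FL.
  have -> //: [ffun u => F (row_mx s u)] = F :> tensor K n q.
  by apply/ffunP=> u; rewrite ffunE row_mx_nil.
have := IH _ (\row_i s 0 (lift 0 i))
  (slice_form (s 0 0) (FL : F \in Lambda K n (p + q).+1)).
suff <- : [ffun u => F (row_mx s u)] =
  [ffun u => slice (F : tensor K n (p + q).+1) (s 0 0)
               (row_mx (\row_i s 0 (lift 0 i)) u)] by [].
by apply/ffunP=> u; rewrite !ffunE {1}(vconsP s) row_mx_vcons.
Qed.

Lemma alt_form k (F : tensor K n k) : F \in Lambda K n k -> alt F = F.
Proof.
move=> FL; apply/ffunP=> t; rewrite ffunE.
under eq_bigr do rewrite (form_perm FL) mulrA -expr2 sqrr_sign mul1r.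
rewrite sumr_const card_Sn -[F t *+ _]mulr_natl.
exact/mulKf/fact_neq0.
Qed.

(** This is the Leibniz formula: the product of the entries selected by [u] is 1 exactly when [s] is
    [t] permuted by [u]. Alternation is from here on expressed by Gram determinants of
    multi-indices. *)
Lemma sum_delta_perm k (s t : 'rV['I_n]_k) :
  \sum_(u : 'S_k) (-1) ^+ u * (s == col_perm u t)%:R =
  \det (\matrix_(i, j) (s 0 i == t 0 j)%:R) :> K.
Proof.
apply: eq_bigr => u _; congr (_ * _).
under eq_bigr do rewrite mxE.
have [/rowP eq_st | neq_st] := eqVneq.
  by rewrite big1 // => i _; rewrite eq_st mxE eqxx.
have /existsP[i /negPf neq_i] : [exists i, s 0 i != t 0 (u i)].
  apply: contraR neq_st => /existsPn eq_st; apply/eqP/rowP=> i.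
  by rewrite mxE; apply/eqP; have := eq_st i; rewrite negbK.
by rewrite (bigD1 i) //= neq_i mul0r.
Qed.

Lemma alt_delta k (s t : 'rV['I_n]_k) :
  alt (delta K s) t = k`!%:R^-1 * \det (\matrix_(i, j) (s 0 i == t 0 j)%:R).
Proof.
rewrite ffunE -sum_delta_perm; congr (_ * _).
by apply: eq_bigr => u _; rewrite ffunE eq_sym.
Qed.

Lemma tensor_sum_delta k (F : tensor K n k) : F = \sum_t F t *: delta K t.
Proof.
apply/ffunP=> u; rewrite sum_ffunE (bigD1 u) //= !ffunE eqxx.
rewrite big1 => [|t /negPf neq_tu].
  by rewrite addr0; apply/esym/mulr1.
by rewrite !ffunE eq_sym neq_tu; apply: mulr0.
Qed.

Lemma altE k (F : tensor K n k) t :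
  alt F t = \sum_s F s * (k`!%:R^-1 * \det (\matrix_(i, j) (s 0 i == t 0 j)%:R)).
Proof.
rewrite {1}(tensor_sum_delta F) linear_sum sum_ffunE.
by apply: eq_bigr => s _; rewrite linearZ ffunE alt_delta.
Qed.

(** The transposition of the two equal entries fixes [t], so [F t] equals its own opposite, and 2 is
    invertible. *)
Lemma form_repeat k (F : tensor K n k) (t : 'rV_k) (i j : 'I_k) :
  F \in Lambda K n k -> i != j -> t 0 i = t 0 j -> F t = 0.
Proof.
move=> FL neq_ij eq_t; suff /eqP: F t *+ 2 = 0 by rewrite mulrn_eq0 => /eqP.
have tE: col_perm (tperm i j) t = t.
  by apply/rowP=> l; rewrite mxE; case: tpermP => // ->.
have := form_perm FL (tperm i j) t.
by rewrite tE odd_tperm neq_ij mulN1r mulr2n => {2}->; rewrite subrr.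
Qed.
End FormsTheory.

Lemma dim_ffun (K : fieldType) (I : finType) : \dim {: {ffun I -> K^o}} = #|I|.
Proof. by rewrite dimvf; apply: muln1. Qed.

Lemma memv_leigenspace (K : fieldType) (V : vectType K) (f : {linear V -> V}) a v :
  (v \in passmx.leigenspace (linfun f) a) = (f v == a *: v).
Proof. by rewrite memv_ker add_lfunE opp_lfunE scale_lfunE !lfunE /= subr_eq0. Qed.

Lemma limg_dim_inj (K : fieldType) (U V : vectType K) (f : 'Hom(U, V)) (W : {vspace U}) :
  {in W, forall x, f x = 0 -> x = 0} -> \dim (f @: W) = \dim W.
Proof.
move=> f0; apply: limg_dim_eq; apply/eqP; rewrite -subv0; apply/subvP=> x.
by rewrite memv_cap memv_ker memv0 => /andP[Wx /eqP/f0 ->].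
Qed.

(** * Dimension of the space of k-forms, through strictly increasing multi-indices *)

Section DimForms.
Variables (K : numFieldType) (n k : nat).
Implicit Types q : k.-tuple 'I_n.

Definition increasing q := sorted ltn (map val q).
Definition tuple_row q : 'rV['I_n]_k := \row_j tnth q j.

Lemma increasing_inj q : increasing q -> injective (tnth q).
Proof.
move=> q_inc; apply/tuple_uniqP; rewrite -(map_inj_uniq val_inj).
exact: sorted_uniq (ltn_trans) ltnn _ q_inc.
Qed.

(** An increasing tuple is determined by its set of entries, which permuting does not change;
    distinctness of the entries then leaves only the trivial permutation. *)
Lemma increasing_perm p q (s : 'S_k) : increasing p -> increasing q ->
  tuple_row p = col_perm s (tuple_row q) -> p = q /\ s = 1%g.
Proof.
move=> p_inc q_inc /rowP pq; have qE i: tnth p i = tnth q (s i).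
  by have:= pq i; rewrite !mxE.
have eq_pq : p = q.
  apply: val_inj; apply: (inj_map val_inj).
  apply: (irr_sorted_eq ltn_trans ltnn) => //; apply: eq_mem_map => x.
  apply/tnthP/tnthP => -[i ->]; first by exists (s i).
  by exists (s^-1 i)%g; rewrite qE permKV.
split=> //; apply/permP=> i; rewrite perm1; apply: (increasing_inj q_inc).
by rewrite -qE eq_pq.
Qed.

(** A multi-index with distinct entries is sorted at the cost of a sign; one with a repetition gives
    0 by antisymmetry. *)
Lemma form_eq0 (F : tensor K n k) : F \in Lambda K n k ->
  (forall q, increasing q -> F (tuple_row q) = 0) -> F = 0.
Proof.
move=> FL F0; apply/ffunP=> t; rewrite ffunE.
pose p := [tuple t 0 i | i < k].
have tE : t = tuple_row p by apply/rowP=> i; rewrite mxE tnth_mktuple.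
have [/tuple_uniqP p_uniq | /tuple_uniqP p_nuniq] := boolP (uniq p); last first.
  have [i [j [neq_ij eq_pij]]] : exists i, exists j, i != j /\ t 0 i = t 0 j.
    have /injectivePn[i [j neq_ij eq_ij]] : ~~ injectiveb (tnth p).
      by apply/injectiveP.
    by exists i, j; rewrite !tnth_mktuple in eq_ij.
  exact: form_repeat FL neq_ij eq_pij.
pose leI := relpre (@nat_of_ord n) leq.
have /tuple_permP[s sE] : perm_eq (sort leI p) p by rewrite perm_sort.
pose q := [tuple tnth p (s i) | i < k].
have q_inc : increasing q.
  rewrite /increasing ltn_sorted_uniq_leq -sE sorted_map.
  rewrite map_inj_uniq ?sort_uniq; last exact: val_inj.
  by rewrite sort_sorted ?andbT; [apply/tuple_uniqP | move=> i j; apply: leq_total].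
apply/eqP; rewrite -(mulrI_eq0 _ (@lregP _ ((-1) ^+ s) _)) ?signr_eq0 //.
rewrite -(form_perm FL); apply/eqP; rewrite -[RHS](F0 q q_inc); congr (F _).
by apply/rowP=> i; rewrite !mxE !tnth_mktuple.
Qed.

Definition increasing_components (F : tensor K n k) :
    {ffun {q | increasing q} -> K^o} := [ffun q => F (tuple_row (val q))].

Fact increasing_components_is_linear : linear increasing_components.
Proof. by move=> a F G; apply/ffunP=> q; rewrite !ffunE. Qed.
HB.instance Definition _ := GRing.isLinear.Build K (tensor K n k)
  {ffun {q | increasing q} -> K^o} _ increasing_components
  increasing_components_is_linear.

Lemma dim_Lambda : \dim (Lambda K n k) = 'C(n, k).
Proof.
rewrite -(@limg_dim_inj _ _ _ (linfun increasing_components)).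
  rewrite (_ : lfun_img _ _ = fullv) ?dim_ffun.
    rewrite card_sig -card_ltn_sorted_tuples cardsE; exact: eq_card.
  apply/vspaceP=> f; rewrite memvf; apply/memv_imgP.
  (* The preimage of [f] alternates the tensor supported on increasing multi-indices. The factorial
     cancels the weight of [alt], because at an increasing multi-index only the identity permutation
     contributes, by [increasing_perm]. *)
  exists (alt [ffun t => \sum_q k`!%:R * f q * (t == tuple_row (val q))%:R]).
    exact: alt_Lambda.
  rewrite lfunE; apply/ffunP=> q; rewrite !ffunE.
  under eq_bigr do rewrite ffunE mulr_sumr.
  rewrite exchange_big /= (bigD1 q) //= [X in _ + X]big1 ?addr0 => [|p neq_pq].
    rewrite (bigD1 1%g) //= big1 ?addr0 => [|s neq_s1].
      rewrite odd_perm1 mul1r col_perm1 eqxx mulr1 mulKf //.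
      exact: fact_neq0.
    case: eqP => [/esym /increasing_perm[] | _]; try exact: valP.
      by move=> _ s1; rewrite s1 eqxx in neq_s1.
    by rewrite !mulr0.
  rewrite big1 // => s _; case: eqP => [/esym/increasing_perm[] | _].
  - exact: valP.
  - exact: valP.
  - by move=> pq; rewrite (val_inj pq) eqxx in neq_pq.
  by rewrite !mulr0.
move=> F FL /ffunP F0; apply: form_eq0 => // q q_inc.
by have:= F0 (exist _ q q_inc); rewrite lfunE !ffunE.
Qed.
End DimForms.

(** * Tensor products and wedge products *)

Section TensorProductTheory.
Variables (K : fieldType) (I J : finType).
Implicit Types (F : {ffun I -> K^o}) (G : {ffun J -> K^o}) (T : {ffun I * J -> K^o}).
Implicit Types (U : {vspace {ffun I -> K^o}}) (V : {vspace {ffun J -> K^o}}).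

Lemma otimes_suml (H : finType) (c : H -> K) (F : H -> {ffun I -> K^o}) G :
  otimes (\sum_h c h *: F h) G = \sum_h c h *: otimes (F h) G.
Proof.
apply/ffunP=> x; rewrite !(ffunE, sum_ffunE) mulr_suml.
by apply: eq_bigr => h _; rewrite !ffunE; apply/esym/mulrA.
Qed.

Lemma otimes_sumr (H : finType) (c : H -> K) F (G : H -> {ffun J -> K^o}) :
  otimes F (\sum_h c h *: G h) = \sum_h c h *: otimes F (G h).
Proof.
apply/ffunP=> x; rewrite !(ffunE, sum_ffunE) mulr_sumr.
by apply: eq_bigr => h _; rewrite !ffunE; apply: mulrCA.
Qed.

Lemma ffun_sum_delta (H : finType) (F : {ffun H -> K^o}) :
  F = \sum_h F h *: [ffun h' => (h' == h)%:R].
Proof.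
apply/ffunP=> u; rewrite sum_ffunE (bigD1 u) //= !ffunE eqxx big1 => [|t /negPf tu].
  by rewrite addr0; apply/esym/mulr1.
by rewrite !ffunE eq_sym tu; apply: mulr0.
Qed.

Lemma memv_otimes F G U V : F \in U -> G \in V -> otimes F G \in otimesv U V.
Proof.
move=> UF VG; rewrite (coord_vbasis UF) (coord_vbasis VG) otimes_suml.
apply: memv_suml => i _; apply: memvZ; rewrite otimes_sumr.
apply: memv_suml => j _; apply: memvZ; apply: memv_span; apply/allpairsP.
by exists ((vbasis U)`_i, (vbasis V)`_j) => /=; split=> //; apply: mem_nth;
  rewrite size_tuple.
Qed.

Lemma otimesv_ind (W : {vspace {ffun I * J -> K^o}}) U V :
  (forall F G, F \in U -> G \in V -> otimes F G \in W) -> (otimesv U V <= W)%VS.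
Proof.
move=> UVW; apply/span_subvP=> T /allpairsP[[F G] [/= UF VG ->]].
by apply: UVW; apply: vbasis_mem.
Qed.

Definition slicel j T : {ffun I -> K^o} := [ffun i => T (i, j)].
Definition slicer i T : {ffun J -> K^o} := [ffun j => T (i, j)].
Fact slicel_is_linear j : linear (slicel j).
Proof. by move=> a F G; apply/ffunP=> i; rewrite !ffunE. Qed.
Fact slicer_is_linear i : linear (slicer i).
Proof. by move=> a F G; apply/ffunP=> j; rewrite !ffunE. Qed.
HB.instance Definition _ j := GRing.isLinear.Build K {ffun I * J -> K^o}
  {ffun I -> K^o} _ (slicel j) (slicel_is_linear j).
HB.instance Definition _ i := GRing.isLinear.Build K {ffun I * J -> K^o}
  {ffun J -> K^o} _ (slicer i) (slicer_is_linear i).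

Lemma slicel_otimes j F G : slicel j (otimes F G) = G j *: F.
Proof. by apply/ffunP=> i; rewrite !ffunE mulrC. Qed.

Lemma slicer_otimes i F G : slicer i (otimes F G) = F i *: G.
Proof. by apply/ffunP=> j; rewrite !ffunE. Qed.

(** This is the identity of [U] tensor everything, intersected with everything tensor [V], with [U]
    tensor [V]. It makes membership in a tensor product testable slice by slice. *)
Lemma otimesvP T U V :
  T \in otimesv U V <-> (forall j, slicel j T \in U) /\ (forall i, slicer i T \in V).
Proof.
split=> [TUV | [TU TV]].
  split=> z.
    suff: (otimesv U V <= linfun (slicel z) @^-1: U)%VS.
      by move/subvP/(_ T TUV); rewrite -memv_preim lfunE.
    apply: otimesv_ind => F G UF VG; rewrite -memv_preim lfunE /= slicel_otimes.
    exact: memvZ.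
  suff: (otimesv U V <= linfun (slicer z) @^-1: V)%VS.
    by move/subvP/(_ T TUV); rewrite -memv_preim lfunE.
  apply: otimesv_ind => F G UF VG; rewrite -memv_preim lfunE /= slicer_otimes.
  exact: memvZ.
(* The slices in [U] are expanded in a basis of [U]. Each coefficient vector [c l] lies in [V],
   since a coordinate is a linear functional and so [c l] is a combination of the slices in [V]. *)
pose c l : {ffun J -> K^o} := [ffun j => coord (vbasis U) l (slicel j T)].
have -> : T = \sum_(l < \dim U) otimes (vbasis U)`_l (c l).
  apply/ffunP=> -[i j]; rewrite sum_ffunE.
  have := congr1 (fun F : {ffun I -> K^o} => F i) (coord_vbasis (TU j)).
  rewrite !(ffunE, sum_ffunE) => ->; apply: eq_bigr => l _; rewrite !ffunE.
  exact: mulrC.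
apply: memv_suml => l _; apply: memv_otimes.
  by apply/vbasis_mem/mem_nth; rewrite size_tuple.
suff -> : c l = \sum_i coord (vbasis U) l [ffun h => (h == i)%:R] *: slicer i T.
  by apply: memv_suml => i _; apply: memvZ.
apply/ffunP=> j; rewrite ffunE [slicel j T]ffun_sum_delta linear_sum sum_ffunE.
by apply: eq_bigr => i _; rewrite linearZ !ffunE; apply: mulrC.
Qed.

End TensorProductTheory.

Section Wedge.
Variable K : numFieldType.

Lemma scale_tensorE (I : finType) a (F : {ffun I -> K^o}) i : (a *: F) i = a * F i.
Proof. by rewrite ffunE. Qed.

Lemma push_delta n N k (f : 'I_n -> 'I_N) (s : 'rV_k) :
  push f (delta K s) = delta K (map_mx f s).
Proof.
apply/ffunP=> t; rewrite !ffunE; have [->|neq_t] := eqVneq t (map_mx f s).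
  rewrite (bigD1 s) //= ffunE eqxx big1 ?addr0 // => s' /andP[_ /negPf ne].
  by rewrite ffunE ne.
apply: big1 => s' /eqP ts'; rewrite ffunE; case: eqP => // ss'.
by rewrite -ts' ss' eqxx in neq_t.
Qed.

Lemma wedge_delta n p q (s : 'rV_p) (u : 'rV_q) :
  wedge (delta K s) (delta K u) =
  'C(p + q, p)%:R *: alt (delta K (row_mx s u)) :> tensor K n (p + q).
Proof.
congr (_ *: alt _); apply/ffunP=> t; rewrite !ffunE -natrM mulnb.
congr (_%:R); congr nat_of_bool; apply/andP/eqP => [[/eqP <- /eqP <-] | ->].
  by rewrite hsubmxK.
by rewrite row_mxKl row_mxKr !eqxx.
Qed.

Lemma wedge_sum n (H L : finType) p q (F : H -> tensor K n p) (G : L -> tensor K n q) a b :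
  wedge (\sum_h a h *: F h) (\sum_l b l *: G l) =
  \sum_h \sum_l (a h * b l) *: wedge (F h) (G l).
Proof.
rewrite /wedge; transitivity ('C(p + q, p)%:R *: alt (\sum_h \sum_l (a h * b l) *:
    [ffun t => F h (lsubmx t) * G l (rsubmx t)] : tensor K n (p + q))).
  congr (_ *: alt _); apply/ffunP=> t; rewrite !(ffunE, sum_ffunE).
  rewrite mulr_suml; apply: eq_bigr => h _; rewrite sum_ffunE mulr_sumr.
  by apply: eq_bigr => l _; rewrite !ffunE; apply: mulrACA.
rewrite linear_sum scaler_sumr; apply: eq_bigr => h _.
rewrite linear_sum scaler_sumr; apply: eq_bigr => l _.
by rewrite linearZ /= !scalerA mulrC.
Qed.

Lemma to_wedge_otimes p q (F : tensor K 8 p) (G : tensor K 2 q) :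
  to_wedge (otimes F G) = wedge (incl8 F) (incl2 G).
Proof.
rewrite [F in RHS]tensor_sum_delta [G in RHS]tensor_sum_delta !linear_sum /=.
under [in RHS]eq_bigr do rewrite linearZ.
under [X in wedge _ X]eq_bigr do rewrite linearZ.
by rewrite wedge_sum; apply: eq_bigr => s _; apply: eq_bigr => u _; rewrite ffunE.
Qed.

Lemma to_wedgeE p q (T : bitensor K p q) :
  to_wedge T = 'C(p + q, p)%:R *: \sum_s \sum_u
    T (s, u) *: alt (delta K (row_mx (map_mx (lshift 2) s) (map_mx (@rshift 8 2) u))).
Proof.
rewrite /to_wedge scaler_sumr; apply: eq_bigr => s _.
rewrite scaler_sumr; apply: eq_bigr => u _.
by rewrite /incl8 /incl2 !push_delta wedge_delta !scalerA mulrC.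
Qed.

Lemma to_wedge_form p q (T : bitensor K p q) : to_wedge T \in Lambda K (8 + 2) (p + q).
Proof.
rewrite to_wedgeE; apply/memvZ/memv_suml => s _; apply: memv_suml => u _.
exact/memvZ/alt_Lambda.
Qed.

Lemma bin_fact_inv p q :
  'C(p + q, p)%:R * (p + q)`!%:R^-1 = p`!%:R^-1 * q`!%:R^-1 :> K.
Proof.
apply: (canLR (mulfK (fact_neq0 _ _))); rewrite -(bin_fact (leq_addr q p)) addKn.
rewrite !natrM mulrCA [X in _ * X](_ : _ = 1) ?mulr1 //.
by rewrite mulrACA !mulVf ?fact_neq0 // mulr1.
Qed.

Lemma alt_sum_delta n k (F : tensor K n k) t :
  alt F t = \sum_s F s * alt (delta K s) t.
Proof. by rewrite altE; apply: eq_bigr => s _; rewrite alt_delta. Qed.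

(* The Gram matrix of two split multi-indices is block diagonal. *)
Lemma alt_delta_split p q (s' s : 'rV_p) (u' u : 'rV_q) :
  'C(p + q, p)%:R *
    alt (delta K (row_mx (map_mx (lshift 2) s') (map_mx (@rshift 8 2) u')))
        (row_mx (map_mx (lshift 2) s) (map_mx (@rshift 8 2) u)) =
  alt (delta K s') s * alt (delta K u') u.
Proof.
rewrite !alt_delta mulrA bin_fact_inv [RHS]mulrACA -(det_ublock _ 0); congr (_ * \det _).
apply/matrixP=> i j; rewrite mxE.
case: (split_ordP i) => i' ->; case: (split_ordP j) => j' ->;
  rewrite ?(row_mxEl, row_mxEr, block_mxEul, block_mxEur, block_mxEdl, block_mxEdr);
  by rewrite !mxE ?(inj_eq (@lshift_inj _ _)) ?(inj_eq (@rshift_inj _ _))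
    ?eq_lrshift ?eq_rlshift.
Qed.

(** The block Gram matrix makes the alternation over all indices act as separate alternations in the
    two factors, and each of these is trivial because the slices of [T] are forms. *)
Lemma to_wedge_row p q (T : bitensor K p q) s u : T \in LambdaLambda K p q ->
  to_wedge T (row_mx (map_mx (lshift 2) s) (map_mx (@rshift 8 2) u)) = T (s, u).
Proof.
move=> /otimesvP[TL TR]; transitivity (alt (slicel u T) s); last first.
  by rewrite alt_form // ffunE.
rewrite alt_sum_delta to_wedgeE ffunE sum_ffunE [LHS]mulr_sumr.
apply: eq_bigr => s' _; rewrite [slicel _ _ _]ffunE sum_ffunE mulr_sumr.
transitivity (alt (slicer s' T) u * alt (delta K s') s); last first.
  by rewrite alt_form // ffunE.
rewrite alt_sum_delta mulr_suml; apply: eq_bigr => u' _.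
rewrite scale_tensorE [slicer _ _ _]ffunE -mulrA [alt _ u * _]mulrC.
by rewrite -alt_delta_split mulrCA.
Qed.

(** The number of indices in the eight-dimensional summand. It is invariant under permutation, and
    [to_wedge] on degree (p, q) is supported where it equals p. *)
Definition lcount k (t : 'rV['I_(8 + 2)]_k) := (\sum_j (t 0%R j < 8))%N.

Lemma lcount_perm k (t : 'rV_k) (s : 'S_k) : lcount (col_perm s t) = lcount t.
Proof.
rewrite /lcount [RHS](reindex_inj (@perm_inj _ s)) /=.
by apply: eq_bigr => i _; rewrite mxE.
Qed.

Lemma lcount_row_mx p q (s : 'rV_p) (u : 'rV_q) :
  lcount (row_mx s u) = (lcount s + lcount u)%N.
Proof.
rewrite /lcount big_split_ord /=; congr addn.
  by apply: eq_bigr => i _; rewrite row_mxEl.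
by apply: eq_bigr => i _; rewrite row_mxEr.
Qed.

Lemma lcount_lshift k (s : 'rV_k) : lcount (map_mx (lshift 2) s) = k.
Proof.
rewrite /lcount (eq_bigr (fun=> 1%N)) ?sum1_card ?card_ord // => i _.
by rewrite mxE /= ltn_ord.
Qed.

Lemma lcount_rshift k (u : 'rV_k) : lcount (map_mx (@rshift 8 2) u) = 0%N.
Proof. by apply: big1 => i _; rewrite mxE. Qed.

Definition lcountE := (lcount_row_mx, lcount_lshift, lcount_rshift, addn0, add0n).

Lemma to_wedge_eq0 p q (T : bitensor K p q) t : lcount t != p -> to_wedge T t = 0.
Proof.
move=> tp; rewrite to_wedgeE ffunE sum_ffunE big1 ?[LHS]mulr0 // => s _.
rewrite sum_ffunE big1 // => u _; rewrite scale_tensorE ffunE.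
rewrite big1 ?[_^-1 * _]mulr0 ?[LHS]mulr0 // => v _; rewrite ffunE.
case: eqP => [tE|]; last by rewrite mulr0.
by rewrite -(lcount_perm t v) tE !lcountE eqxx in tp.
Qed.
End Wedge.

(** * Three-forms in ten dimensions *)

Section ThreeForms.
Variable K : numFieldType.

Section Swaps.
Variable n : nat.

Lemma form_swap2 k (F : tensor K n k.+4) a b c d t : F \in Lambda K n k.+4 ->
  F (a ::: b ::: c ::: d ::: t) = - F (a ::: b ::: d ::: c ::: t).
Proof. by move/(slice_form a)/form_swap1=> /(_ c d b t); rewrite !ffunE. Qed.

Lemma form_swap3 k (F : tensor K n k.+4.+1) a b c d e t :
  F \in Lambda K n k.+4.+1 ->
  F (a ::: b ::: c ::: d ::: e ::: t) = - F (a ::: b ::: c ::: e ::: d ::: t).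
Proof. by move/(slice_form a)/form_swap2=> /(_ b c d e t); rewrite !ffunE. Qed.

Lemma form_swap4 k (F : tensor K n k.+4.+2) a b c d e f t :
  F \in Lambda K n k.+4.+2 ->
  F (a ::: b ::: c ::: d ::: e ::: f ::: t) =
  - F (a ::: b ::: c ::: d ::: f ::: e ::: t).
Proof. by move/(slice_form a)/form_swap3=> /(_ b c d e f t); rewrite !ffunE. Qed.

Lemma form_repeat0 k (F : tensor K n k.+2) a t : F \in Lambda K n k.+2 ->
  F (a ::: a ::: t) = 0.
Proof.
by move=> FL; apply: (form_repeat FL (_ : 0 != lift 0 0)) => //; rewrite !vconsE.
Qed.

Lemma form_repeat1 k (F : tensor K n k.+3) a b t : F \in Lambda K n k.+3 ->
  F (b ::: a ::: a ::: t) = 0.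
Proof. by move/(slice_form b)/form_repeat0=> /(_ a t); rewrite !ffunE. Qed.

(** For variable [p], [p + 0] does not reduce to [p], so positions are matched by value. Together
    with [lsubmx_nilr] this removes the empty block from [duality] when r = 0. *)
Lemma row_mx_nilr p (s : 'rV['I_n]_p) (u : 'rV_0) (i : 'I_p) (j : 'I_(p + 0)) :
  i = j :> nat -> row_mx s u 0 j = s 0 i.
Proof.
move=> ij; have -> : j = lshift 0 i by apply: val_inj.
by rewrite row_mxEl.
Qed.

Lemma lsubmx_nilr p (t : 'rV['I_n]_(p + 0)) (i : 'I_p) (j : 'I_(p + 0)) :
  i = j :> nat -> lsubmx t 0 i = t 0 j.
Proof. by move=> ij; rewrite mxE; congr (t 0 _); apply: val_inj. Qed.

(* For r = 0 the antisymmetrization in [duality] is redundant. *)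
Lemma duality2E (Om : tensor K n 4) (F : tensor K n 2) t :
  Om \in Lambda K n 4 ->
  @duality K n 2 0 Om F t = \sum_(j : 'rV_2) Om (row_mx j (t : 'rV_2) : 'rV_(2 + 2)) * F j.
Proof.
(* The tensor under [alt] is rewritten as a combination of slices of [Om] in its last two indices,
   hence as a form, which [alt] fixes. *)
move=> OmL; transitivity ((alt (\sum_(j : 'rV_2)
    F j *: [ffun t => Om (row_mx j t : 'rV_(2 + 2))]) : tensor K n 2) t).
  congr ((alt _ : tensor K n 2) _); apply/ffunP=> u; rewrite ffunE sum_ffunE.
  apply: eq_bigr => j _; rewrite !ffunE mulrC; congr (F _ * Om (row_mx j _)).
    by apply/rowP=> i; apply: row_mx_nilr.
  by apply/rowP=> i; apply: lsubmx_nilr.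
rewrite alt_form; first by rewrite sum_ffunE; apply: eq_bigr => j _; rewrite !ffunE mulrC.
by apply: memv_suml => j _; apply/memvZ/(@row_slice_form _ _ 2 2 Om j OmL).
Qed.

Lemma duality3E (Om : tensor K n 6) (F : tensor K n 3) t :
  Om \in Lambda K n 6 ->
  @duality K n 3 0 Om F t = \sum_(j : 'rV_3) Om (row_mx j (t : 'rV_3) : 'rV_(3 + 3)) * F j.
Proof.
move=> OmL; transitivity ((alt (\sum_(j : 'rV_3)
    F j *: [ffun t => Om (row_mx j t : 'rV_(3 + 3))]) : tensor K n 3) t).
  congr ((alt _ : tensor K n 3) _); apply/ffunP=> u; rewrite ffunE sum_ffunE.
  apply: eq_bigr => j _; rewrite !ffunE mulrC; congr (F _ * Om (row_mx j _)).
    by apply/rowP=> i; apply: row_mx_nilr.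
  by apply/rowP=> i; apply: lsubmx_nilr.
rewrite alt_form; first by rewrite sum_ffunE; apply: eq_bigr => j _; rewrite !ffunE mulrC.
by apply: memv_suml => j _; apply/memvZ/(@row_slice_form _ _ 3 3 Om j OmL).
Qed.
End Swaps.

(** Pigeonhole in the plane: a form has no component with three plane indices, which leaves only
    three types of components. *)
Lemma ord2_repeat (a b c : 'I_2) : [|| a == b, b == c | a == c].
Proof. by case: a b c => [[|[|//]] ?] [[|[|//]] ?] [[|[|//]] ?]. Qed.

Lemma vcons_ex n k (t : 'rV['I_n]_k.+1) : exists a s, t = a ::: s.
Proof. by exists (t 0 0), (\row_i t 0 (lift 0 i)); apply: vconsP. Qed.

(** Adjacent swaps bring any index triple to the order low indices first, plane indices last; three
    plane indices give 0 on both sides. *)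
Lemma three_form_eq (F G : tensor K (8 + 2) 3) :
  F \in Lambda K (8 + 2) 3 -> G \in Lambda K (8 + 2) 3 ->
  (forall a b c, F (lo a ::: lo b ::: lo c ::: vnil) =
                 G (lo a ::: lo b ::: lo c ::: vnil)) ->
  (forall a b c, F (lo a ::: lo b ::: hi c ::: vnil) =
                 G (lo a ::: lo b ::: hi c ::: vnil)) ->
  (forall a b c, F (lo a ::: hi b ::: hi c ::: vnil) =
                 G (lo a ::: hi b ::: hi c ::: vnil)) -> F = G.
Proof.
move=> FL GL eq0 eq1 eq2; apply/ffunP=> t.
have [x [u ->]] := vcons_ex t; have [y [v ->]] := vcons_ex u.
have [z [w ->]] := vcons_ex v; rewrite (row0_eq w vnil).
have sw0 a b c : F (a ::: b ::: c ::: vnil) = G (a ::: b ::: c ::: vnil) ->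
    F (b ::: a ::: c ::: vnil) = G (b ::: a ::: c ::: vnil).
  by move=> FG; rewrite form_swap0 // FG -form_swap0.
have sw1 a b c : F (a ::: b ::: c ::: vnil) = G (a ::: b ::: c ::: vnil) ->
    F (a ::: c ::: b ::: vnil) = G (a ::: c ::: b ::: vnil).
  by move=> FG; rewrite form_swap1 // FG -form_swap1.
case: (split_ordP x) => a ->; case: (split_ordP y) => b ->;
  case: (split_ordP z) => c ->; auto.
have /or3P[/eqP->|/eqP->|/eqP->] := ord2_repeat a b c.
- by rewrite !form_repeat0.
- by rewrite !form_repeat1.
by apply: sw1; rewrite !form_repeat0.
Qed.

(** Of the eight patterns of low and plane indices, the mixed ones fall into two groups of three,
    and the symmetry of [f] makes the members of each group contribute equally. *)
Lemma sum_by_type (f : 'I_(8 + 2) -> 'I_(8 + 2) -> 'I_(8 + 2) -> K) :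
  (forall x y z, f x y z = f y x z) -> (forall x y z, f x y z = f x z y) ->
  \sum_x \sum_y \sum_z f x y z =
    \sum_a \sum_b \sum_c f (lo a) (lo b) (lo c)
    + 3 * (\sum_a \sum_b \sum_c f (lo a) (lo b) (hi c))
    + 3 * (\sum_a \sum_b \sum_c f (lo a) (hi b) (hi c))
    + \sum_a \sum_b \sum_c f (hi a) (hi b) (hi c).
Proof.
move=> f01 f12.
have hll a b c : f (hi c) (lo a) (lo b) = f (lo a) (lo b) (hi c) by rewrite f01 f12.
have hhl a b c : f (hi b) (hi c) (lo a) = f (lo a) (hi b) (hi c) by rewrite f12 f01.
have split2 (g : 'I_(8 + 2) -> 'I_(8 + 2) -> K) : \sum_y \sum_z g y z =
    \sum_b \sum_c g (lo b) (lo c) + \sum_b \sum_c g (lo b) (hi c)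
    + (\sum_b \sum_c g (hi b) (lo c) + \sum_b \sum_c g (hi b) (hi c)).
  by rewrite big_split_ord -!big_split; congr (_ + _); apply: eq_bigr => b _;
    rewrite big_split_ord.
rewrite big_split_ord /=.
under eq_bigr do rewrite split2.
under [X in _ + X]eq_bigr do rewrite split2.
rewrite !big_split /=.
have -> : \sum_a \sum_b \sum_c f (lo a) (hi b) (lo c) =
    \sum_a \sum_b \sum_c f (lo a) (lo b) (hi c).
  apply: eq_bigr => a _; rewrite exchange_big.
  by apply: eq_bigr => b _; apply: eq_bigr => c _; apply: f12.
have -> : \sum_a \sum_b \sum_c f (hi a) (lo b) (lo c) =
    \sum_a \sum_b \sum_c f (lo a) (lo b) (hi c).
  rewrite exchange_big; apply: eq_bigr => a _; rewrite exchange_big.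
  by apply: eq_bigr => b _; apply: eq_bigr => c _; apply: hll.
have -> : \sum_a \sum_b \sum_c f (hi a) (lo b) (hi c) =
    \sum_a \sum_b \sum_c f (lo a) (hi b) (hi c).
  rewrite exchange_big; apply: eq_bigr => a _.
  by apply: eq_bigr => b _; apply: eq_bigr => c _; apply: f01.
have -> : \sum_a \sum_b \sum_c f (hi a) (hi b) (lo c) =
    \sum_a \sum_b \sum_c f (lo a) (hi b) (hi c).
  under eq_bigr do rewrite exchange_big.
  rewrite exchange_big; apply: eq_bigr => a _.
  by apply: eq_bigr => b _; apply: eq_bigr => c _; apply: hhl.
ring.
Qed.
End ThreeForms.

(** * The lifted six-form and its contractions with a three-form, by type of component *)

Section Lift.
Variable K : numFieldType.

Local Notation th a b c d := (Theta K (a ::: b ::: c ::: d ::: vnil)).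
Local Notation ep a b := (epsilon K (a ::: b ::: vnil)).

Lemma ThetaE t : Theta K t =
  \sum_(q <- Theta_table) \det (\matrix_(i, j) (t 0 i == Theta_index q 0 j)%:R).
Proof. by rewrite ffunE; apply: eq_bigr => q _; rewrite sum_delta_perm. Qed.

(** Each listed component contributes 4! times an alternated delta tensor; passing between the two
    expressions exchanges the two multi-indices, that is, transposes the Gram matrix. *)
Lemma Theta_form : Theta K \in Lambda K 8 4.
Proof.
suff -> : Theta K = \sum_(q <- Theta_table) 4`!%:R *: alt (delta K (Theta_index q)).
  by apply: memv_suml => q _; apply/memvZ/alt_Lambda.
apply/ffunP=> t; rewrite ThetaE sum_ffunE; apply: eq_bigr => q _.
rewrite scale_tensorE alt_delta mulVKf ?fact_neq0 // -det_tr; congr (\det _).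
by apply/matrixP=> i j; rewrite !mxE eq_sym.
Qed.

Lemma epsilon_form : epsilon K \in Lambda K 2 2.
Proof. exact/memvZ/alt_Lambda. Qed.

Lemma epsilon_const a : ep a a = 0.
Proof. exact: form_repeat0 epsilon_form. Qed.

Lemma epsilon01 : ep 0 1 = 1.
Proof.
rewrite /epsilon /basis_form wedge_delta scale_tensorE alt_delta !const_vcons.
rewrite row_mx_vcons row_mx_nil mulrA divff ?mul1r ?(fact_neq0 K 2) //.
rewrite (_ : \matrix_(i, j) _ = 1%:M) ?det1 //.
apply/matrixP=> i j; rewrite [LHS]mxE [RHS]mxE.
by case: (unliftP 0 i) => [i'|] ->; case: (unliftP 0 j) => [j'|] ->;
  rewrite ?(vcons0, vcons_lift) ?ord1 ?vcons0.
Qed.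

Lemma epsilon10 : ep 1 0 = -1.
Proof. by rewrite form_swap0 ?epsilon01 // epsilon_form. Qed.

Definition epsilonE := (epsilon_const, epsilon01, epsilon10).

Lemma Theta_hatE a b c d e f :
  Theta_hat K (lo a ::: lo b ::: lo c ::: lo d ::: hi e ::: hi f ::: vnil) =
  th a b c d * ep e f.
Proof.
have := @to_wedge_row K 4 2 (otimes (Theta K) (epsilon K))
  (a ::: b ::: c ::: d ::: vnil) (e ::: f ::: vnil).
rewrite to_wedge_otimes !map_vcons !map_vnil !row_mx_vcons row_mx_nil ffunE => -> //.
  by rewrite ffunE.
exact: (memv_otimes Theta_form epsilon_form).
Qed.

Lemma Theta_hat_eq0 t : lcount t != 4 -> Theta_hat K t = 0.
Proof.
by move/(@to_wedge_eq0 K 4 2 (otimes (Theta K) (epsilon K))); rewrite to_wedge_otimes.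
Qed.

Lemma Theta_hat_form : Theta_hat K \in Lambda K (8 + 2) 6.
Proof. exact/memvZ/alt_Lambda. Qed.

Lemma lcount_vcons k a (t : 'rV_k) : lcount (a ::: t) = ((a < 8) + lcount t)%N.
Proof.
rewrite /lcount big_ord_recl vcons0; congr addn.
by apply: eq_bigr => i _; rewrite vcons_lift.
Qed.

Lemma lcount_vnil : lcount vnil = 0%N. Proof. exact: big_ord0. Qed.

Lemma lo_lt a : (lo a < 8)%N = true. Proof. by rewrite /= ltn_ord. Qed.
Lemma hi_lt a : (hi a < 8)%N = false. Proof. by []. Qed.

Definition lcount_vconsE := (lcount_vcons, lcount_vnil, lo_lt, hi_lt).

Lemma Theta_hat_LRR_LLL i e f l m n :
  Theta_hat K (lo i ::: hi e ::: hi f ::: lo l ::: lo m ::: lo n ::: vnil) =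
  th i l m n * ep e f.
Proof.
rewrite -Theta_hatE; have TL := Theta_hat_form.
(* Moving two plane indices past three low ones takes six swaps, so no sign remains. *)
rewrite (form_swap2 _ _ _ _ _ TL) (form_swap1 _ _ _ _ TL) (form_swap3 _ _ _ _ _ _ TL).
rewrite (form_swap2 _ _ _ _ _ TL) (form_swap4 _ _ _ _ _ _ _ TL).
by rewrite (form_swap3 _ _ _ _ _ _ TL) !opprK.
Qed.

Lemma Theta_hat_LLR_LLR i j e l m f :
  Theta_hat K (lo i ::: lo j ::: hi e ::: lo l ::: lo m ::: hi f ::: vnil) =
  th i j l m * ep e f.
Proof.
rewrite -Theta_hatE; have TL := Theta_hat_form.
by rewrite (form_swap2 _ _ _ _ _ TL) (form_swap3 _ _ _ _ _ _ TL) opprK.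
Qed.

Variable X : tensor K (8 + 2) 3.
Hypothesis XL : X \in Lambda K (8 + 2) 3.

Lemma high_form_eq0 a b c : X (hi a ::: hi b ::: hi c ::: vnil) = 0.
Proof.
have /or3P[/eqP->|/eqP->|/eqP->] := ord2_repeat a b c.
- by rewrite form_repeat0.
- by rewrite form_repeat1.
by rewrite form_swap1 // form_repeat0 // oppr0.
Qed.

(** Under a swap of contracted indices [Theta_hat] and [X] both change sign, so their product is
    symmetric and [sum_by_type] applies; its last sum vanishes with the purely planar components of
    [X]. *)
Lemma b_Theta_hat_by_type x y z :
  let T := fun i j k => Theta_hat K (i ::: j ::: k ::: x ::: y ::: z ::: vnil) *
                        X (i ::: j ::: k ::: vnil) in
  b_Theta_hat X (x ::: y ::: z ::: vnil) =
    \sum_a \sum_b \sum_c T (lo a) (lo b) (lo c)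
    + 3 * (\sum_a \sum_b \sum_c T (lo a) (lo b) (hi c))
    + 3 * (\sum_a \sum_b \sum_c T (lo a) (hi b) (hi c)).
Proof.
move=> T; have TL := Theta_hat_form.
rewrite /b_Theta_hat duality3E //.
transitivity (\sum_i \sum_j \sum_k T i j k).
  do 3![rewrite sum_vcons; apply: eq_bigr => ? _].
  by rewrite sum_vnil !row_mx_vcons row_mx_nil.
rewrite sum_by_type.
- rewrite [X in _ + X]big1 ?addr0 // => a _; rewrite big1 // => b _.
  by rewrite big1 // => c _; rewrite /T high_form_eq0 mulr0.
- by move=> i j k; rewrite /T (form_swap0 _ _ _ TL) (form_swap0 _ _ _ XL) mulrNN.
by move=> i j k; rewrite /T (form_swap1 _ _ _ _ TL) (form_swap1 _ _ _ _ XL) mulrNN.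
Qed.

(** A nonzero component of [Theta_hat] has exactly four low indices. Three low free indices leave
    one low contracted index; in the two lemmas that follow, two and three are left. *)
Lemma b_Theta_hat_LLL a b c :
  b_Theta_hat X (lo a ::: lo b ::: lo c ::: vnil) =
  3 * \sum_i \sum_e \sum_f
    th i a b c * ep e f * X (lo i ::: hi e ::: hi f ::: vnil).
Proof.
rewrite b_Theta_hat_by_type [X in X + _ + _]big1 1?[X in _ + _ * X + _]big1
  ?mulr0 ?add0r.
- congr (_ * _); do 3![apply: eq_bigr => ? _]; by rewrite Theta_hat_LRR_LLL.
- by do 3![move=> ? _; rewrite ?big1 //]; rewrite Theta_hat_eq0 ?mul0r ?lcount_vconsE.
by do 3![move=> ? _; rewrite ?big1 //]; rewrite Theta_hat_eq0 ?mul0r ?lcount_vconsE.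
Qed.

Lemma b_Theta_hat_LLR a b c :
  b_Theta_hat X (lo a ::: lo b ::: hi c ::: vnil) =
  3 * \sum_i \sum_j \sum_e
    th i j a b * ep e c * X (lo i ::: lo j ::: hi e ::: vnil).
Proof.
rewrite b_Theta_hat_by_type [X in X + _ + _]big1 1?[X in _ + _ + _ * X]big1
  ?mulr0 ?add0r ?addr0.
- congr (_ * _); do 3![apply: eq_bigr => ? _]; by rewrite Theta_hat_LLR_LLR.
- by do 3![move=> ? _; rewrite ?big1 //]; rewrite Theta_hat_eq0 ?mul0r ?lcount_vconsE.
by do 3![move=> ? _; rewrite ?big1 //]; rewrite Theta_hat_eq0 ?mul0r ?lcount_vconsE.
Qed.

Lemma b_Theta_hat_LRR a b c :
  b_Theta_hat X (lo a ::: hi b ::: hi c ::: vnil) =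
  \sum_i \sum_j \sum_k th i j k a * ep b c * X (lo i ::: lo j ::: lo k ::: vnil).
Proof.
rewrite b_Theta_hat_by_type [X in _ + _ * X + _]big1 1?[X in _ + _ + _ * X]big1
  ?mulr0 ?addr0.
- by do 3![apply: eq_bigr => ? _]; rewrite Theta_hatE.
- by do 3![move=> ? _; rewrite ?big1 //]; rewrite Theta_hat_eq0 ?mul0r ?lcount_vconsE.
by do 3![move=> ? _; rewrite ?big1 //]; rewrite Theta_hat_eq0 ?mul0r ?lcount_vconsE.
Qed.
End Lift.

(** * Components of Theta as integers *)

Definition sumz n (f : nat -> int) : int := foldr (fun j s => f j + s) 0 (iota 0 n).

(* Laplace expansion of the determinant of the matrix [t_i == q_j]. *)
Fixpoint detz (t q : seq nat) : int :=
  if t is a :: t' then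
    sumz (size q) (fun j => if a == nth 0%N q j
      then (-1) ^+ odd j * detz t' (take j q ++ drop j.+1 q) else 0)
  else 1.

Definition theta_entry a b c d : int :=
  foldr (fun q s => detz [:: a; b; c; d] (map predn q) + s) 0 Theta_table.

(** Tabulated so that the checks look components up instead of expanding determinants each time. *)
Definition theta_table := mkseq (fun a => mkseq (fun b => mkseq (fun c =>
  mkseq (theta_entry a b c) 8) 8) 8) 8.

Definition lookup T (a b c d : nat) : int :=
  nth 0 (nth [::] (nth [::] (nth [::] T a) b) c) d.

Definition theta := lookup theta_table.

Definition kron (a b : nat) : int := if a == b then 1 else 0.

Definition for8 (P : nat -> bool) := all P (iota 0 8).

(* Components of e_Theta o et_Theta = -42. *)
Definition check_e_et (th : nat -> nat -> nat -> nat -> int) := for8 (fun i => for8 (fun l =>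
  sumz 8 (fun a => sumz 8 (fun b => sumz 8 (fun c => th a b c l * th i a b c)))
  == -42 * kron i l)).

(* Components of b_Theta^2 = 12 - 4 b_Theta on two-forms. *)
Definition check_b_b (th : nat -> nat -> nat -> nat -> int) :=
  for8 (fun i => for8 (fun j => for8 (fun p => for8 (fun q =>
  sumz 8 (fun k => sumz 8 (fun l => th k l i j * th p q k l))
  == 6 * (kron p i * kron q j - kron q i * kron p j) - 4 * th p q i j)))).

(* The contraction over the last axis, which shows that a two-form in the
   eigenspace of -6 is determined by its components F_{a8}. *)
Definition check_b_8 (th : nat -> nat -> nat -> nat -> int) :=
  for8 (fun i => for8 (fun j => for8 (fun k => for8 (fun l =>
  [|| i == 7, j == 7, k == 7, l == 7 |
  sumz 8 (fun a => th a 7 i j * th k l a 7)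
  == kron k i * kron l j - kron l i * kron k j - th k l i j])))).

(* 6 times the coefficient of F_{ijk} in b_Theta(F)_{lmn}. *)
Definition b3_coef (th : nat -> nat -> nat -> nat -> int) l m n i j k :=
  sumz 8 (fun a => sumz 8 (fun b => let x := th i j a b in
    if x == 0 then 0 else x * detz [:: a; b; k] [:: l; m; n])).

(* The coefficients of 18 (b_Theta - 2/3 - et_Theta o e_Theta / 9) on
   three-forms; they vanish only after antisymmetrization in (i, j, k). *)
Definition b3_et_e_coef (th : nat -> nat -> nat -> nat -> int) l m n i j k :=
  3 * b3_coef th l m n i j k - 12 * kron i l * kron j m * kron k n
  - 2 * sumz 8 (fun p => th p l m n * th i j k p).

(** For fixed (l, m, n) each coefficient is read at six permuted positions, hence the table. *)
Definition table3 (N : nat -> nat -> nat -> int) :=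
  mkseq (fun i => mkseq (fun j => mkseq (N i j) 8) 8) 8.

Definition lookup3 T (i j k : nat) : int := nth 0 (nth [::] (nth [::] T i) j) k.

(** The signed sum runs over the six permutations of (i, j, k). Free indices with l < m < n suffice,
    because a three-form is determined by its increasing components. *)
Definition check_b3 (th : nat -> nat -> nat -> nat -> int) :=
  for8 (fun l => for8 (fun m => for8 (fun n => if ~~ (l < m < n)%N then true else
  let N := lookup3 (table3 (b3_et_e_coef th l m n)) in
  for8 (fun i => for8 (fun j => for8 (fun k =>
    N i j k + N j k i + N k i j - N j i k - N i k j - N k j i == 0)))))).

Lemma check_e_etP : check_e_et theta. Proof. by vm_compute. Qed.
Lemma check_b_bP : check_b_b theta. Proof. by vm_compute. Qed.
Lemma check_b_8P : check_b_8 theta. Proof. by vm_compute. Qed.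
Lemma check_b3P : check_b3 theta. Proof. by vm_compute. Qed.

Section Numeric.
Variable K : numFieldType.

Lemma sumzE n (f : nat -> int) : (sumz n f)%:~R = \sum_(j < n) (f j)%:~R :> K.
Proof.
rewrite -(big_mkord xpredT (fun j => (f j)%:~R)) /index_iota subn0 /sumz.
by elim: iota => [|j s IH]; rewrite ?big_nil // big_cons -IH -intrD.
Qed.

Lemma for8P (P : nat -> bool) : for8 P -> forall i : 'I_8, P i.
Proof. by move=> /allP allP i; apply: allP; rewrite mem_iota /= ltn_ord. Qed.

Lemma detzE k (t q : seq nat) : size t = k -> size q = k ->
  \det (\matrix_(i < k, j < k) (nth 0%N t i == nth 0%N q j)%:R) = (detz t q)%:~R :> K.
Proof.
elim: k t q => [|k IH] [|a t] q //=; first by rewrite det_mx00.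
move=> [sz_t] sz_q; rewrite (expand_det_row _ 0) sz_q sumzE; apply: eq_bigr => j _.
rewrite mxE /=; case: eqP => _; last by rewrite mul0r.
rewrite mul1r intrM /cofactor add0n rmorphXn /= rmorphN1 signr_odd; congr (_ * _).
rewrite -(IH _ (take j q ++ drop j.+1 q)) //; last first.
  by rewrite size_cat size_take size_drop sz_q ltn_ord subSS subnKC // -ltnS.
congr (\det _); apply/matrixP=> i l; rewrite !mxE /= nth_cat size_takel; last first.
  by rewrite sz_q ltnW.
(* [bump j l] skips column [j], just as the concatenation of [take] and [drop] does. *)
congr ((nth _ t i == _)%:R); rewrite /bump; case: ltnP => lj.
  by rewrite nth_take // leqNgt lj.
by rewrite nth_drop addSn subnKC ?lj.
Qed.

Lemma val_vcons n k e (u : 'rV['I_n]_k) h (v : seq nat) :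
    (forall h' : 'I_k, val (u 0 h') = nth 0%N v h') ->
  val ((e ::: u) 0 h) = nth 0%N (val e :: v) h.
Proof. by move=> uv; case: (unliftP 0 h) => [h'|] ->; rewrite vconsE //= -uv. Qed.

Lemma val_vnil n h : val ((vnil : 'rV['I_n]_0) 0 h) = nth 0%N [::] h.
Proof. by case: h. Qed.

Lemma Theta_theta (a b c d : 'I_8) :
  Theta K (a ::: b ::: c ::: d ::: vnil) = (theta a b c d)%:~R.
Proof.
rewrite /theta /lookup /theta_table !nth_mkseq ?ltn_ord // ThetaE /theta_entry.
(* Every listed index lowered by one is below 8, so [inord] in [Theta_index] returns that index and
   not its default value. *)
have : all (fun q => (size q == 4) && all (fun x => x.-1 < 8)%N q) Theta_table by [].
set det4 := detz [:: (a : nat); (b : nat); (c : nat); (d : nat)].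
elim: Theta_table => [|q s IH] /=; first by rewrite big_nil.
case/andP=> /andP[/eqP sz_q /allP q8] /IH {}IH; rewrite big_cons intrD -IH.
congr (_ + _); rewrite /det4 -(@detzE 4) ?size_map //; congr (\det _).
apply/matrixP=> i j; rewrite !mxE -val_eqE /= (nth_map 0%N) ?sz_q //.
rewrite inordK; last by apply/q8/mem_nth; rewrite sz_q.
congr ((_ == _)%:R).
transitivity (val ((a ::: b ::: c ::: d ::: vnil) 0 i)); first by rewrite mxE.
by do 4![apply: val_vcons => ?]; apply: val_vnil.
Qed.

Lemma kronE n (a b : 'I_n) : (kron a b)%:~R = (a == b)%:R :> K.
Proof. by rewrite /kron val_eqE; case: eqP. Qed.

End Numeric.

(** * The operators on R^8 *)

Section Operators.
Variable K : numFieldType.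

Local Notation th a b c d := (Theta K (a ::: b ::: c ::: d ::: vnil)).

Lemma tensor1_eq n (F G : tensor K n 1) : (forall a, F (idx1 a) = G (idx1 a)) -> F = G.
Proof.
by move=> FG; apply/ffunP=> t; have [a [s ->]] := vcons_ex t; rewrite (row0_eq s vnil).
Qed.

Lemma tensor2_eq n (F G : tensor K n 2) :
  (forall a b, F (idx2 a b) = G (idx2 a b)) -> F = G.
Proof.
move=> FG; apply/ffunP=> t; have [a [s ->]] := vcons_ex t.
by have [b [u ->]] := vcons_ex s; rewrite (row0_eq u vnil).
Qed.

Lemma b_Theta2E (F : tensor K 8 2) a b :
  b_Theta2 F (idx2 a b) = \sum_i \sum_j th i j a b * F (idx2 i j).
Proof.
rewrite /b_Theta2 duality2E ?Theta_form //.
do 2![rewrite sum_vcons; apply: eq_bigr => ? _].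
by rewrite sum_vnil !row_mx_vcons row_mx_nil.
Qed.

Lemma e_ThetaE (F : tensor K 8 3) l :
  e_Theta F (idx1 l) = \sum_i \sum_j \sum_k th i j k l * F (idx3 i j k).
Proof.
rewrite ffunE; do 3![rewrite sum_vcons; apply: eq_bigr => ? _].
by rewrite sum_vnil !row_mx_vcons row_mx_nil.
Qed.

Lemma et_ThetaE (F : tensor K 8 1) a b c :
  et_Theta F (idx3 a b c) = \sum_i th i a b c * F (idx1 i).
Proof.
rewrite ffunE sum_vcons; apply: eq_bigr => i _.
by rewrite sum_vnil !row_mx_vcons row_mx_nil.
Qed.

(** For r = 1 the antisymmetrization is genuine. It is kept as a sum of Gram determinants with
    weight 1/3! and moved into integer coefficients of the components of [F]. *)
Lemma b_Theta3E (F : tensor K 8 3) l m n :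
  b_Theta3 F (idx3 l m n) = 6^-1 * \sum_(i < 8) \sum_(j < 8) \sum_(k < 8)
    (b3_coef theta l m n i j k)%:~R * F (idx3 i j k).
Proof.
have -> : b_Theta3 F = alt ([ffun t => \sum_(j : 'rV_2)
    Theta K (row_mx j (lsubmx t)) * F (row_mx j (rsubmx t))] : tensor K 8 (2 + 1)) by [].
rewrite altE; transitivity (\sum_a \sum_b \sum_k \sum_i \sum_j
  th i j a b * F (idx3 i j k) *
  (6^-1 * (detz [:: (a : nat); (b : nat); (k : nat)]
                 [:: (l : nat); (m : nat); (n : nat)])%:~R)).
  rewrite sum_vcons; apply: eq_bigr => a _; rewrite sum_vcons; apply: eq_bigr => b _.
  rewrite sum_vcons; apply: eq_bigr => k _; rewrite sum_vnil.
  have -> : idx3 a b k = row_mx (idx2 a b) (idx1 k) :> 'rV_(2 + 1).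
    by rewrite !row_mx_vcons row_mx_nil.
  rewrite [X in X * _](_ : _ = \sum_i \sum_j th i j a b * F (idx3 i j k)).
    rewrite mulr_suml; apply: eq_bigr => i _; rewrite mulr_suml; apply: eq_bigr => j _.
    congr (_ * (_ * _)); rewrite -(@detzE _ 3) //; congr (\det _).
    apply/matrixP=> x y; rewrite [LHS]mxE [RHS]mxE -val_eqE !row_mx_vcons row_mx_nil.
    by congr ((_ == _)%:R); do 3![apply: val_vcons => ?]; apply: val_vnil.
  rewrite ffunE row_mxKl row_mxKr.
  do 2![rewrite sum_vcons; apply: eq_bigr => ? _].
  by rewrite sum_vnil !row_mx_vcons !row_mx_nil.
have coefE (i j k : 'I_8) : (b3_coef theta l m n i j k)%:~R = \sum_(a < 8) \sum_(b < 8)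
    th i j a b * (detz [:: (a : nat); (b : nat); (k : nat)]
                       [:: (l : nat); (m : nat); (n : nat)])%:~R :> K.
  rewrite /b3_coef sumzE; apply: eq_bigr => a _; rewrite sumzE; apply: eq_bigr => b _.
  by rewrite Theta_theta -intrM; case: eqP => // ->; rewrite mul0r.
rewrite mulr_sumr.
transitivity (\sum_k \sum_i \sum_j \sum_a \sum_b
  th i j a b * F (idx3 i j k) * (6^-1 * (detz [:: (a : nat); (b : nat); (k : nat)]
    [:: (l : nat); (m : nat); (n : nat)])%:~R)); last first.
  rewrite exchange_big; apply: eq_bigr => i _; rewrite mulr_sumr exchange_big.
  apply: eq_bigr => j _; rewrite mulr_sumr; apply: eq_bigr => k _; rewrite coefE.
  rewrite mulr_suml mulr_sumr; apply: eq_bigr => a _; rewrite mulr_suml mulr_sumr.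
  by apply: eq_bigr => b _; ring.
under eq_bigr do rewrite exchange_big.
rewrite exchange_big; apply: eq_bigr => k _.
under eq_bigr do rewrite exchange_big.
rewrite exchange_big; apply: eq_bigr => i _.
under eq_bigr do rewrite exchange_big.
by rewrite exchange_big.
Qed.

Lemma et_Theta_form (F : tensor K 8 1) : et_Theta F \in Lambda K 8 3.
Proof.
have -> : et_Theta F = \sum_(i : 'rV_1) F i *: [ffun t => Theta K (row_mx i t : 'rV_(1 + 3))].
  apply/ffunP=> t; rewrite ffunE sum_ffunE; apply: eq_bigr => i _.
  by rewrite scale_tensorE [in RHS]ffunE mulrC.
apply: memv_suml => i _; apply/memvZ.
exact: (@row_slice_form K 8 1 3 (Theta K) i (Theta_form K)).
Qed.

Lemma e_Theta_et (F : tensor K 8 1) : e_Theta (et_Theta F) = -42 *: F.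
Proof.
apply: tensor1_eq => l; rewrite e_ThetaE scale_tensorE.
transitivity (\sum_i (\sum_a \sum_b \sum_c th a b c l * th i a b c) * F (idx1 i)).
  under eq_bigr do under eq_bigr do under eq_bigr do rewrite et_ThetaE mulr_sumr.
  under eq_bigr do under eq_bigr do rewrite exchange_big.
  under eq_bigr do rewrite exchange_big.
  rewrite exchange_big; apply: eq_bigr => i _.
  do 3![rewrite mulr_suml; apply: eq_bigr => ? _]; exact: mulrA.
have contr i : \sum_a \sum_b \sum_c th a b c l * th i a b c = -42 * (i == l)%:R.
  have /(for8P)/(_ i)/for8P/(_ l)/eqP := check_e_etP.
  move=> /(congr1 (fun z => z%:~R : K)); rewrite intrM kronE rmorphN /= => <-.
  do 3![rewrite sumzE; apply: eq_bigr => ? _]; by rewrite intrM !Theta_theta.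
under eq_bigr do rewrite contr.
rewrite (bigD1 l) //= eqxx mulr1 big1 ?addr0 // => i /negPf ->.
by rewrite mulr0 mul0r.
Qed.

Lemma sum2_delta n (F : tensor K n 2) x y :
  \sum_p \sum_q (p == x)%:R * (q == y)%:R * F (idx2 p q) = F (idx2 x y).
Proof.
rewrite (bigD1 x) //= [X in _ + X]big1 ?addr0 => [|p /negPf px].
  rewrite (bigD1 y) //= big1 ?addr0 ?eqxx ?mul1r // => q /negPf ->.
  by rewrite mulr0 mul0r.
by apply: big1 => q _; rewrite px !mul0r.
Qed.

Lemma b_Theta2_b (F : tensor K 8 2) : F \in Lambda K 8 2 ->
  b_Theta2 (b_Theta2 F) = 12 *: F - 4 *: b_Theta2 F.
Proof.
move=> FL; apply: tensor2_eq => a b; rewrite b_Theta2E.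
transitivity (\sum_p \sum_q (\sum_i \sum_j th i j a b * th p q i j) * F (idx2 p q)).
  under eq_bigr do under eq_bigr do rewrite b_Theta2E mulr_sumr.
  under eq_bigr do rewrite exchange_big.
  rewrite exchange_big; apply: eq_bigr => p _.
  under eq_bigr do under eq_bigr do rewrite mulr_sumr.
  under eq_bigr do rewrite exchange_big.
  rewrite exchange_big; apply: eq_bigr => q _.
  do 2![rewrite mulr_suml; apply: eq_bigr => ? _]; exact: mulrA.
have contr p q : \sum_i \sum_j th i j a b * th p q i j =
    6 * ((p == a)%:R * (q == b)%:R - (q == a)%:R * (p == b)%:R) - 4 * th p q a b.
  have /(for8P)/(_ a)/for8P/(_ b)/for8P/(_ p)/for8P/(_ q)/eqP := check_b_bP.
  move=> /(congr1 (fun z => z%:~R : K)); rewrite Theta_theta -!kronE.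
  rewrite !(rmorphB, rmorphM) /= => <-.
  do 2![rewrite sumzE; apply: eq_bigr => ? _]; by rewrite intrM !Theta_theta.
under eq_bigr do under eq_bigr do rewrite contr.
(* The Kronecker deltas antisymmetrize [F]; as [F] is a form the two terms agree, and 6 becomes
   12. *)
transitivity (6 * (F (idx2 a b) - F (idx2 b a)) - 4 * b_Theta2 F (idx2 a b)).
  rewrite b_Theta2E -!(sum2_delta F) -sumrB !mulr_sumr -sumrB; apply: eq_bigr => p _.
  rewrite -sumrB !mulr_sumr -sumrB; apply: eq_bigr => q _.
  ring.
rewrite (form_swap0 b a _ FL) !(ffunE, scale_tensorE).
by rewrite /GRing.scale /=; ring.
Qed.

(** Renaming the summation indices and reordering those of [F] rewrites the sum in six ways, with
    signed permuted coefficients. Six times the sum therefore has the antisymmetrized coefficients,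
    all of which are 0. *)
Lemma sum3_antisym (F : tensor K 8 3) (N : 'I_8 -> 'I_8 -> 'I_8 -> K) :
  F \in Lambda K 8 3 ->
  (forall i j k,
     N i j k + N j k i + N k i j - N j i k - N i k j - N k j i = 0) ->
  \sum_i \sum_j \sum_k N i j k * F (idx3 i j k) = 0.
Proof.
move=> FL N0; set S := LHS.
have sw0 i j k : F (idx3 i j k) = - F (idx3 j i k) by apply: form_swap0.
have sw1 i j k : F (idx3 i j k) = - F (idx3 i k j) by apply: form_swap1.
have S_jik : S = - \sum_i \sum_j \sum_k N j i k * F (idx3 i j k).
  rewrite /S exchange_big -!sumrN; apply: eq_bigr => i _; rewrite -sumrN.
  apply: eq_bigr => j _; rewrite -sumrN; apply: eq_bigr => k _.
  by rewrite sw0 mulrN.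
have S_ikj : S = - \sum_i \sum_j \sum_k N i k j * F (idx3 i j k).
  rewrite /S -!sumrN; apply: eq_bigr => i _; rewrite exchange_big -sumrN.
  apply: eq_bigr => j _; rewrite -sumrN; apply: eq_bigr => k _.
  by rewrite sw1 mulrN.
have S_jki : S = \sum_i \sum_j \sum_k N j k i * F (idx3 i j k).
  rewrite S_ikj exchange_big -!sumrN; apply: eq_bigr => i _; rewrite -sumrN.
  apply: eq_bigr => j _; rewrite -sumrN; apply: eq_bigr => k _.
  by rewrite sw0 mulrN opprK.
have S_kij : S = \sum_i \sum_j \sum_k N k i j * F (idx3 i j k).
  rewrite S_jik -!sumrN; apply: eq_bigr => i _; rewrite exchange_big -sumrN.
  apply: eq_bigr => j _; rewrite -sumrN; apply: eq_bigr => k _.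
  by rewrite sw1 mulrN opprK.
have S_kji : S = - \sum_i \sum_j \sum_k N k j i * F (idx3 i j k).
  rewrite S_kij exchange_big -!sumrN; apply: eq_bigr => i _; rewrite -sumrN.
  apply: eq_bigr => j _; rewrite -sumrN; apply: eq_bigr => k _.
  by rewrite sw0 mulrN.
suff /eqP : S *+ 6 = 0 by rewrite mulrn_eq0 => /eqP.
transitivity (S + S + S + S + S + S); first by ring.
rewrite {2}S_jki {2}S_kij {2}S_jik {2}S_ikj {2}S_kji /S -!sumrN -!big_split.
rewrite big1 // => i _; rewrite -!sumrN -!big_split big1 // => j _.
rewrite -!sumrN -!big_split big1 // => k _ /=.
by rewrite -!mulNr -!mulrDl N0 mul0r.
Qed.

Lemma three_form_eq0 (F : tensor K 8 3) : F \in Lambda K 8 3 ->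
  (forall l m n : 'I_8, (l < m < n)%N -> F (idx3 l m n) = 0) -> F = 0.
Proof.
move=> FL F0; apply: form_eq0 FL _ => -[[|l [|m [|n []]]] //= sz].
rewrite /increasing /= andbT => /F0 <-; congr (F _); apply/rowP=> i.
apply: val_inj; transitivity (nth 0%N [:: val l; val m; val n] i).
  by rewrite mxE (tnth_nth l) /=; case: i => -[|[|[|//]]].
by apply: esym; do 3![apply: val_vcons => ?]; apply: val_vnil.
Qed.

Lemma b_Theta3_et_e (F : tensor K 8 3) : F \in Lambda K 8 3 ->
  b_Theta3 F = 2 / 3 *: F + 9^-1 *: et_Theta (e_Theta F).
Proof.
move=> FL; apply/eqP; rewrite -subr_eq0; apply/eqP.
apply: three_form_eq0 => [|l m n lmn].
  by rewrite memvB ?memvD ?memvZ ?et_Theta_form //; apply: alt_Lambda.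
pose N (i j k : 'I_8) : K := (b3_et_e_coef theta l m n i j k)%:~R.
(* 18 is a common denominator of 1/6 from [b_Theta3E], 2/3 and 1/9; it gives the factors 3, 12 and 2
   in [b3_et_e_coef]. *)
transitivity (18^-1 * \sum_(i < 8) \sum_(j < 8) \sum_(k < 8) N i j k * F (idx3 i j k)).
  have sub3E (A B C' : tensor K 8 3) t : (A - (2 / 3 *: B + 9^-1 *: C')) t =
      A t - (2 / 3 * B t + 9^-1 * C' t) by rewrite !ffunE.
  rewrite sub3E b_Theta3E et_ThetaE.
  have deltaE : F (idx3 l m n) = \sum_(i < 8) \sum_(j < 8) \sum_(k < 8)
      (i == l)%:R * (j == m)%:R * (k == n)%:R * F (idx3 i j k).
    rewrite (bigD1 l) //= [X in _ + X]big1 ?addr0 => [|i /negPf il]; last first.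
      by do 2![apply: big1 => ? _]; rewrite il !mul0r.
    rewrite (bigD1 m) //= [X in _ + X]big1 ?addr0 => [|j /negPf jm]; last first.
      by apply: big1 => ? _; rewrite jm mulr0 !mul0r.
    rewrite (bigD1 n) //= big1 ?addr0 => [|k /negPf kn]; last first.
      by rewrite kn mulr0 !mul0r.
    by rewrite !eqxx !mul1r.
  have -> : \sum_p th p l m n * e_Theta F (idx1 p) =
      \sum_(i < 8) \sum_(j < 8) \sum_(k < 8)
        (sumz 8 (fun p => theta p l m n * theta i j k p))%:~R * F (idx3 i j k).
    under eq_bigr do rewrite e_ThetaE mulr_sumr.
    rewrite exchange_big; apply: eq_bigr => i _.
    under eq_bigr do rewrite mulr_sumr.
    rewrite exchange_big; apply: eq_bigr => j _.
    under eq_bigr do rewrite mulr_sumr.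
    rewrite exchange_big; apply: eq_bigr => k _.
    rewrite sumzE mulr_suml; apply: eq_bigr => p _.
    by rewrite intrM !Theta_theta mulrA.
  rewrite {}deltaE !mulr_sumr -!big_split -sumrB; apply: eq_bigr => i _.
  rewrite !mulr_sumr -!big_split -sumrB; apply: eq_bigr => j _.
  rewrite !mulr_sumr -!big_split -sumrB; apply: eq_bigr => k _ /=.
  rewrite /N /b3_et_e_coef !(rmorphB, rmorphM) /= !kronE; by field.
rewrite (sum3_antisym (N := N) FL) ?mulr0 // => i j k; rewrite /N.
have := check_b3P; rewrite /check_b3.
move/for8P/(_ l)/for8P/(_ m)/for8P/(_ n); rewrite lmn /=.
move/for8P/(_ i)/for8P/(_ j)/for8P/(_ k)/eqP.
rewrite /lookup3 /table3 !nth_mkseq // => N0.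
by rewrite -!(rmorphD, rmorphB) /= N0.
Qed.
End Operators.

Lemma form_eigenspaceP (K : fieldType) n k (f : {linear tensor K n k -> tensor K n k}) a F :
  reflect (F \in Lambda K n k /\ f F = a *: F) (F \in form_eigenspace f a).
Proof.
by rewrite memv_cap memv_leigenspace; apply: (iffP andP) => -[? /eqP].
Qed.

(** * Eigenspaces of b on two-forms and their dimensions *)

Section EigenTwoForms.
Variable K : numFieldType.

Local Notation th a b c d := (Theta K (a ::: b ::: c ::: d ::: vnil)).
Local Notation L2 a := (form_eigenspace (@b_Theta2 K) a).

Lemma b_Theta2_form (F : tensor K 8 2) : b_Theta2 F \in Lambda K 8 2.
Proof. exact: alt_Lambda. Qed.

Lemma b_Theta2_eigenvalue a (F : tensor K 8 2) : F \in Lambda K 8 2 ->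
  b_Theta2 F = a *: F -> F != 0 -> (a == 2) || (a == -6).
Proof.
move=> FL bF F0; have := b_Theta2_b FL; rewrite bF linearZ /= bF !scalerA -scalerBl.
move/eqP; rewrite -subr_eq0 -scalerBl scaler_eq0 (negPf F0) orbF.
by rewrite (_ : _ - _ = (a - 2) * (a + 6)) ?mulf_eq0 ?subr_eq0 ?addr_eq0 //; ring.
Qed.

Lemma Lambda2_decomposition : Lambda K 8 2 = (L2 (-6) + L2 2)%VS.
Proof.
have L2S a : (L2 a <= Lambda K 8 2)%VS by apply: capvSl.
apply/eqP; rewrite eqEsubv; apply/andP; split; last first.
  by rewrite subv_add; apply/andP; split; apply: L2S.
apply/subvP=> F FL; have bL := b_Theta2_form F; have bb := b_Theta2_b FL.
(* These are the spectral projections (2 - b)/8 and (6 + b)/8 of the quadratic (b - 2)(b + 6) = 0; 8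
   is the distance between the roots. *)
have -> : F = 8^-1 *: (2 *: F - b_Theta2 F) + 8^-1 *: (6 *: F + b_Theta2 F).
  by move: (b_Theta2 F) => G; apply/ffunP=> t; rewrite !ffunE /GRing.scale /=; field.
apply: memv_add; apply: memvZ; apply/form_eigenspaceP; split;
  rewrite ?memvD ?memvN ?memvZ //=.
  rewrite linearB linearZ /= bb; move: (b_Theta2 F) => G; apply/ffunP=> t.
  by rewrite !ffunE /GRing.scale /=; ring.
rewrite linearD linearZ /= bb; move: (b_Theta2 F) => G; apply/ffunP=> t.
by rewrite !ffunE /GRing.scale /=; ring.
Qed.

Lemma eigenspaces_disjoint : (L2 (-6) :&: L2 2)%VS = 0%VS.
Proof.
apply/eqP; rewrite -subv0; apply/subvP=> F /memv_capP[].
move=> /form_eigenspaceP[_ bF] /form_eigenspaceP[_]; rewrite bF => /eqP.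
rewrite -subr_eq0 -scalerBl scaler_eq0 memv0 => /orP[|//].
by rewrite (_ : -6 - 2 = - 8%:R) ?oppr_eq0 ?pnatr_eq0 //; ring.
Qed.

Definition last_components (F : tensor K 8 2) : {ffun 'I_7 -> K^o} :=
  [ffun a => F (idx2 (lift ord_max a) ord_max)].
Fact last_components_is_linear : linear last_components.
Proof. by move=> a F G; apply/ffunP=> q; rewrite !ffunE. Qed.
HB.instance Definition _ := GRing.isLinear.Build K (tensor K 8 2)
  {ffun 'I_7 -> K^o} _ last_components last_components_is_linear.

Definition restrict7 (F : tensor K 8 2) : tensor K 7 2 :=
  [ffun t => F (map_mx (lift ord_max) t)].
Fact restrict7_is_linear : linear restrict7.
Proof. by move=> a F G; apply/ffunP=> q; rewrite !ffunE. Qed.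
HB.instance Definition _ := GRing.isLinear.Build K (tensor K 8 2)
  (tensor K 7 2) _ restrict7 restrict7_is_linear.

Lemma restrict7_form F : F \in Lambda K 8 2 -> restrict7 F \in Lambda K 7 2.
Proof.
move=> FL; apply/LambdaP=> s t; rewrite !ffunE -(form_perm FL); congr (F _).
by apply/rowP=> i; rewrite !mxE.
Qed.

(** If [F] vanishes on the first seven axes, then a nonzero term of the contraction giving 2 F_{a8}
    must have an index 8 on [F], but then [Theta] carries 8 twice. So F_{a8} vanishes too and
    [restrict7] is injective on the eigenspace. *)
Lemma dim_eigenspace2_le : (\dim (L2 2) <= 21)%N.
Proof.
rewrite -(@limg_dim_inj _ _ _ (linfun restrict7)).
  rewrite -[21%N]/('C(7, 2)) -(dim_Lambda K 7 2); apply: dimvS.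
  apply/subvP=> _ /memv_imgP[F /form_eigenspaceP[FL _] ->]; rewrite lfunE.
  exact: restrict7_form.
move=> F /form_eigenspaceP[FL bF]; rewrite lfunE => /ffunP F7.
have F0 a b : F (idx2 (lift ord_max a) (lift ord_max b)) = 0.
  by have:= F7 (a ::: b ::: vnil); rewrite !ffunE !map_vcons map_vnil.
have F8 a : F (idx2 a ord_max) = 0.
  have := congr1 (fun G : tensor K 8 2 => G (idx2 a ord_max)) bF.
  rewrite b_Theta2E scale_tensorE big1 => [/esym/eqP|i _].
    by rewrite mulf_eq0 pnatr_eq0 => /eqP.
  have ThL := Theta_form K.
  apply: big1 => j _; case: (unliftP ord_max j) => [j'|] ->; last first.
    by rewrite (form_swap2 _ _ _ _ _ ThL) form_repeat1 // oppr0 mul0r.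
  case: (unliftP ord_max i) => [i'|] ->; first by rewrite F0 mulr0.
  rewrite (form_swap2 _ _ _ _ _ ThL) (form_swap1 _ _ _ _ ThL) form_repeat0 //.
  by rewrite !oppr0 mul0r.
apply: tensor2_eq => a b; rewrite ffunE.
case: (unliftP ord_max b) => [b'|] -> //; case: (unliftP ord_max a) => [a'|] -> //.
by rewrite form_swap0 // F8 oppr0.
Qed.

(** Suppose all F_{a8} vanish. Then (bF)_{a8} = -6 F_{a8} = 0, and contracting it with Theta_{a8ij}
    gives, by [check_b_8P], 0 = 2 F_{ij} - (bF)_{ij} = 8 F_{ij}. *)
Lemma dim_eigenspaceN6_le : (\dim (L2 (-6)) <= 7)%N.
Proof.
rewrite -(@limg_dim_inj _ _ _ (linfun last_components)).
  by rewrite (leq_trans (dimvS (subvf _))) // dim_ffun card_ord.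
move=> F /form_eigenspaceP[FL bF]; rewrite lfunE => /ffunP F7.
have F8 a : F (idx2 a ord_max) = 0.
  case: (unliftP ord_max a) => [a'|] ->; last exact: form_repeat0.
  by have:= F7 a'; rewrite !ffunE.
have F8' a : F (idx2 ord_max a) = 0 by rewrite form_swap0 // F8 oppr0.
apply: tensor2_eq => i j; rewrite [RHS]ffunE.
have [-> //|i7] := eqVneq i ord_max; have [-> //|j7] := eqVneq j ord_max.
have : \sum_a th a ord_max i j * b_Theta2 F (idx2 a ord_max) = 0.
  by apply: big1 => a _; rewrite bF scale_tensorE F8 !mulr0.
under eq_bigr do (rewrite b_Theta2E mulr_sumr; under eq_bigr do rewrite mulr_sumr).
have contr k l : \sum_a th a ord_max i j * (th k l a ord_max * F (idx2 k l)) =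
    (k == i)%:R * (l == j)%:R * F (idx2 k l) - (k == j)%:R * (l == i)%:R * F (idx2 k l)
    - th k l i j * F (idx2 k l).
  (* If [k] or [l] is the last axis, both sides vanish with the component of [F]; [check_b_8] covers
     the other cases. *)
  have [->|k7] := eqVneq k ord_max.
    by rewrite F8' !mulr0 !subr0 big1 // => a _; rewrite !mulr0.
  have [->|l7] := eqVneq l ord_max.
    by rewrite F8 !mulr0 !subr0 big1 // => a _; rewrite !mulr0.
  have /(for8P)/(_ i)/for8P/(_ j)/for8P/(_ k)/for8P/(_ l) := check_b_8P.
  rewrite -!(val_eqE _ ord_max) /= in i7 j7 k7 l7.
  rewrite (negPf i7) (negPf j7) (negPf k7) (negPf l7) /= => /eqP.
  move/(congr1 (fun z => z%:~R * F (idx2 k l))).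
  rewrite sumzE !(rmorphB, rmorphM) /= !kronE mulr_suml [_ * (k == j)%:R]mulrC.
  rewrite Theta_theta -!mulrBl => <-; apply: eq_bigr => a _.
  by rewrite intrM !Theta_theta mulrA.
rewrite exchange_big /=.
under eq_bigr do (rewrite exchange_big /=; under eq_bigr do rewrite contr).
move=> eq0; have: F (idx2 i j) - F (idx2 j i) - b_Theta2 F (idx2 i j) = 0.
  rewrite b_Theta2E -!(sum2_delta F) -!sumrB -[RHS]eq0; apply: eq_bigr => k _.
  by rewrite -!sumrB.
rewrite bF scale_tensorE (form_swap0 j i _ FL) => F8ij.
have /eqP : 8 * F (idx2 i j) = 0 by rewrite -[RHS]F8ij; ring.
by rewrite mulf_eq0 pnatr_eq0 => /eqP.
Qed.

Lemma dim_eigenspaces2 : \dim (L2 (-6)) = 7%N /\ \dim (L2 2) = 21%N.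
Proof.
have := dim_Lambda K 8 2; rewrite Lambda2_decomposition.
rewrite (dimv_disjoint_sum eigenspaces_disjoint) (_ : 'C(8, 2) = 28) // => dim_sum.
have := dim_eigenspaceN6_le; have := dim_eigenspace2_le.
lia.
Qed.
End EigenTwoForms.

(** * The block form of the operator *)

Section OtimesMap.
Variables (K : fieldType) (I J I' J' : finType).
Variable A : {linear {ffun I -> K^o} -> {ffun I' -> K^o}}.
Variable B : {linear {ffun J -> K^o} -> {ffun J' -> K^o}}.

Lemma otimes_map_is_linear : linear (otimes_map A B).
Proof.
move=> a S T; apply/ffunP=> -[i' j']; rewrite !ffunE /=.
rewrite -[RHS](_ : (a *: A [ffun i => B [ffun j => S (i, j)] j']
                    + A [ffun i => B [ffun j => T (i, j)] j']) i' = _); last by rewrite !ffunE.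
rewrite -linearP; congr (A _ _); apply/ffunP=> i; rewrite !ffunE.
rewrite -[RHS](_ : (a *: B [ffun j => S (i, j)] + B [ffun j => T (i, j)]) j' = _);
  last by rewrite !ffunE.
by rewrite -linearP; congr (B _ _); apply/ffunP=> j; rewrite !ffunE.
Qed.
HB.instance Definition _ := GRing.isLinear.Build K {ffun I * J -> K^o}
  {ffun I' * J' -> K^o} _ (otimes_map A B) otimes_map_is_linear.

Lemma otimes_map_otimes F G : otimes_map A B (otimes F G) = otimes (A F) (B G).
Proof.
apply/ffunP=> -[i' j']; rewrite !ffunE /=.
transitivity ((B G j' *: A F) i'); last by rewrite ffunE; apply: mulrC.
rewrite -linearZ; congr (A _ _); apply/ffunP=> i; rewrite !ffunE.
transitivity ((F i *: B G) j'); last by rewrite ffunE; apply: mulrC.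
by rewrite -linearZ; congr (B _ _); apply/ffunP=> j; rewrite !ffunE.
Qed.

Lemma memv_otimes_map (U : {vspace {ffun I -> K^o}}) (V : {vspace {ffun J -> K^o}})
    (U' : {vspace {ffun I' -> K^o}}) (V' : {vspace {ffun J' -> K^o}}) T :
  (forall F, F \in U -> A F \in U') -> (forall G, G \in V -> B G \in V') ->
  T \in otimesv U V -> otimes_map A B T \in otimesv U' V'.
Proof.
move=> AU BV; suff: (otimesv U V <= linfun (otimes_map A B) @^-1: otimesv U' V')%VS.
  by move/subvP=> sub /sub; rewrite -memv_preim lfunE.
apply: otimesv_ind => F G UF VG; rewrite -memv_preim lfunE /= otimes_map_otimes.
by apply: memv_otimes; [apply: AU | apply: BV].
Qed.
End OtimesMap.

Section SmallForms.
Variables (K : numFieldType) (n : nat).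

Lemma Lambda0_full (F : tensor K n 0) : F \in Lambda K n 0.
Proof.
apply/LambdaP=> s t; have -> : s = 1%g by apply/permP=> -[].
by rewrite odd_perm1 mul1r col_perm1.
Qed.

Lemma Lambda1_full (F : tensor K n 1) : F \in Lambda K n 1.
Proof.
apply/LambdaP=> s t; have -> : s = 1%g by apply/permP=> i; rewrite !ord1.
by rewrite odd_perm1 mul1r col_perm1.
Qed.

Lemma pullback_form m (f : 'I_m -> 'I_n) k (F : tensor K n k) :
  F \in Lambda K n k -> [ffun t => F (map_mx f t)] \in Lambda K m k.
Proof.
move=> FL; apply/LambdaP=> s t; rewrite !ffunE -(form_perm FL); congr (F _).
by apply/rowP=> i; rewrite !mxE.
Qed.
End SmallForms.

Section Block.
Variable K : numFieldType.

Fact e_Theta_is_linear : linear (@e_Theta K).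
Proof.
move=> a F G; apply/ffunP=> t; rewrite !ffunE scaler_sumr -big_split.
by apply: eq_bigr => s _; rewrite !ffunE mulrDr [_ * (_ *: _)]mulrCA.
Qed.
HB.instance Definition _ := GRing.isLinear.Build K (tensor K 8 3) (tensor K 8 1) _
  (@e_Theta K) e_Theta_is_linear.

Fact et_Theta_is_linear : linear (@et_Theta K).
Proof.
move=> a F G; apply/ffunP=> t; rewrite !ffunE scaler_sumr -big_split.
by apply: eq_bigr => s _; rewrite !ffunE mulrDr [_ * (_ *: _)]mulrCA.
Qed.
HB.instance Definition _ := GRing.isLinear.Build K (tensor K 8 1) (tensor K 8 3) _
  (@et_Theta K) et_Theta_is_linear.

HB.instance Definition _ := GRing.isLinear.Build K (tensor K 2 0) (tensor K 2 2) _
  (@star0 K) (@hodge_is_linear K 2 2 0 (epsilon K)).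
HB.instance Definition _ := GRing.isLinear.Build K (tensor K 2 2) (tensor K 2 0) _
  (@star2 K) (@hodge_is_linear K 2 0 2 (epsilon K)).

Local Notation th a b c d := (Theta K (a ::: b ::: c ::: d ::: vnil)).
Local Notation ep a b := (epsilon K (a ::: b ::: vnil)).

Lemma star0E (V : tensor K 2 0) a b : star0 V (idx2 a b) = ep a b * V vnil.
Proof.
by rewrite ffunE invr1 mul1r sum_vnil !row_mx_vcons row_mx_nil.
Qed.

Lemma star1E (V : tensor K 2 1) a : star1 V (idx1 a) = \sum_b ep a b * V (idx1 b).
Proof.
rewrite ffunE invr1 mul1r sum_vcons; apply: eq_bigr => b _.
by rewrite sum_vnil !row_mx_vcons row_mx_nil.
Qed.

Lemma star2E (V : tensor K 2 2) :
  star2 V vnil = 2^-1 * \sum_a \sum_b ep a b * V (idx2 a b).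
Proof.
rewrite ffunE; congr (_ * _); do 2![rewrite sum_vcons; apply: eq_bigr => ? _].
by rewrite sum_vnil row_mx_nil.
Qed.

Lemma star0_form V : star0 V \in Lambda K 2 2.
Proof.
have -> : star0 V = V vnil *: epsilon K.
  apply/tensor2_eq => a b; by rewrite star0E [RHS]ffunE; apply: mulrC.
exact/memvZ/epsilon_form.
Qed.

Variable x1 : bitensor K 3 0.
Variable x2 : bitensor K 2 1.
Variable x3 : bitensor K 1 2.
Hypothesis xP : in_summands (x1, x2, x3).

Lemma assemble_form : assemble (x1, x2, x3) \in Lambda K (8 + 2) 3.
Proof.
apply: memvD; [apply: memvD |].
- exact: (to_wedge_form x1).
- exact: (to_wedge_form x2).
exact: (to_wedge_form x3).
Qed.

Lemma to_wedge30 a b c : to_wedge x1 (idx3 (lo a) (lo b) (lo c)) = x1 (idx3 a b c, vnil).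
Proof.
have [x1P _ _] := xP; rewrite -(to_wedge_row (idx3 a b c) vnil x1P).
by rewrite !map_vcons !map_vnil !row_mx_vcons row_mx_nil.
Qed.

Lemma to_wedge21 a b c : to_wedge x2 (idx3 (lo a) (lo b) (hi c)) = x2 (idx2 a b, idx1 c).
Proof.
have [_ x2P _] := xP; rewrite -(to_wedge_row (idx2 a b) (idx1 c) x2P).
by rewrite !map_vcons !map_vnil !row_mx_vcons row_mx_nil.
Qed.

Lemma to_wedge12 a b c : to_wedge x3 (idx3 (lo a) (hi b) (hi c)) = x3 (idx1 a, idx2 b c).
Proof.
have [_ _ x3P] := xP; rewrite -(to_wedge_row (idx1 a) (idx2 b c) x3P).
by rewrite !map_vcons !map_vnil !row_mx_vcons row_mx_nil.
Qed.

Lemma assembleE t : assemble (x1, x2, x3) t = to_wedge x1 t + to_wedge x2 t + to_wedge x3 t.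
Proof. by rewrite !ffunE. Qed.

Lemma assemble_LLL a b c :
  assemble (x1, x2, x3) (idx3 (lo a) (lo b) (lo c)) = x1 (idx3 a b c, vnil).
Proof.
rewrite assembleE to_wedge30 (@to_wedge_eq0 _ 2 1) ?(@to_wedge_eq0 _ 1 2) ?addr0 //;
by rewrite !lcount_vconsE.
Qed.

Lemma assemble_LLR a b c :
  assemble (x1, x2, x3) (idx3 (lo a) (lo b) (hi c)) = x2 (idx2 a b, idx1 c).
Proof.
rewrite assembleE to_wedge21 (@to_wedge_eq0 _ 3 0) ?(@to_wedge_eq0 _ 1 2) ?addr0 ?add0r //;
by rewrite !lcount_vconsE.
Qed.

Lemma assemble_LRR a b c :
  assemble (x1, x2, x3) (idx3 (lo a) (hi b) (hi c)) = x3 (idx1 a, idx2 b c).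
Proof.
rewrite assembleE to_wedge12 (@to_wedge_eq0 _ 3 0) ?(@to_wedge_eq0 _ 2 1) ?addr0 ?add0r //;
by rewrite !lcount_vconsE.
Qed.
End Block.

Section Decomposition.
Variable K : numFieldType.

Local Notation th a b c d := (Theta K (a ::: b ::: c ::: d ::: vnil)).
Local Notation ep a b := (epsilon K (a ::: b ::: vnil)).

Lemma bitensor_eq p q (S T : bitensor K p q) : (forall s u, S (s, u) = T (s, u)) -> S = T.
Proof. by move=> ST; apply/ffunP=> -[s u]. Qed.

Lemma bitensor30_eq (S T : bitensor K 3 0) :
  (forall a b c, S (idx3 a b c, vnil) = T (idx3 a b c, vnil)) -> S = T.
Proof.
move=> ST; apply: bitensor_eq => s u; have [a [s' ->]] := vcons_ex s.
have [b [t ->]] := vcons_ex s'; have [c [t' ->]] := vcons_ex t.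
by rewrite (row0_eq t' vnil) (row0_eq u vnil).
Qed.

Lemma bitensor21_eq (S T : bitensor K 2 1) :
  (forall a b c, S (idx2 a b, idx1 c) = T (idx2 a b, idx1 c)) -> S = T.
Proof.
move=> ST; apply: bitensor_eq => s u; have [a [s' ->]] := vcons_ex s.
have [b [t ->]] := vcons_ex s'; have [c [u' ->]] := vcons_ex u.
by rewrite (row0_eq t vnil) (row0_eq u' vnil).
Qed.

Lemma bitensor12_eq (S T : bitensor K 1 2) :
  (forall a b c, S (idx1 a, idx2 b c) = T (idx1 a, idx2 b c)) -> S = T.
Proof.
move=> ST; apply: bitensor_eq => s u; have [a [s' ->]] := vcons_ex s.
have [b [t ->]] := vcons_ex u; have [c [t' ->]] := vcons_ex t.
by rewrite (row0_eq s' vnil) (row0_eq t' vnil).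
Qed.

Lemma assemble_inj (x y : triple K) : in_summands x -> in_summands y ->
  assemble x = assemble y -> x = y.
Proof.
case: x y => -[x1 x2] x3 [[y1 y2] y3] xP yP xy.
have -> : x1 = y1.
  by apply: bitensor30_eq => a b c; rewrite -(assemble_LLL xP) xy assemble_LLL.
have -> : x2 = y2.
  by apply: bitensor21_eq => a b c; rewrite -(assemble_LLR xP) xy assemble_LLR.
have -> // : x3 = y3.
by apply: bitensor12_eq => a b c; rewrite -(assemble_LRR xP) xy assemble_LRR.
Qed.

Lemma assemble_surj (F : tensor K (8 + 2) 3) : F \in Lambda K (8 + 2) 3 ->
  exists2 x : triple K, in_summands x & assemble x = F.
Proof.
move=> FL.
pose x1 : bitensor K 3 0 := [ffun z => F (map_mx lo z.1)].
(* The plane index is placed first because slicing at leading indices yields a form; returning it to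
   the end takes two swaps and costs no sign. *)
pose x2 : bitensor K 2 1 :=
  [ffun z => F (row_mx (map_mx hi z.2) (map_mx lo z.1) : 'rV_(1 + 2))].
pose x3 : bitensor K 1 2 :=
  [ffun z => F (row_mx (map_mx lo z.1) (map_mx hi z.2) : 'rV_(1 + 2))].
have xP : in_summands (x1, x2, x3).
  split; apply/otimesvP; split=> s; try exact: Lambda0_full; try exact: Lambda1_full.
  - rewrite (_ : slicel s x1 = [ffun t => F (map_mx lo t)]) ?pullback_form //.
    by apply/ffunP=> t; rewrite !ffunE.
  - have := pullback_form lo (@row_slice_form _ _ 1 2 F (map_mx hi s) FL).
    rewrite (_ : finfun _ = slicel s x2) //.
    by apply/ffunP=> t; rewrite !ffunE.
  have := pullback_form hi (@row_slice_form _ _ 1 2 F (map_mx lo s) FL).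
  rewrite (_ : finfun _ = slicer s x3) //.
  by apply/ffunP=> t; rewrite !ffunE.
exists (x1, x2, x3) => //; apply: three_form_eq => // [|a b c|a b c|a b c].
- exact: assemble_form.
- by rewrite assemble_LLL // ffunE /= !map_vcons map_vnil.
- rewrite assemble_LLR // ffunE /= !map_vcons !map_vnil row_mx_vcons row_mx_nil.
  by rewrite [RHS]form_swap1 // [X in _ = - X]form_swap0 // opprK.
by rewrite assemble_LRR // ffunE /= !map_vcons !map_vnil row_mx_vcons row_mx_nil.
Qed.

Lemma block_operator_in_summands (x : triple K) :
  in_summands x -> in_summands (block_operator x).
Proof.
case: x => -[x1 x2] x3 [x1P x2P x3P]; split.
- apply: memvZ; apply: memv_otimes_map x3P => [F _|G _].
    exact: et_Theta_form.
  exact: Lambda0_full.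
- apply: memvZ; apply: memv_otimes_map x2P => [F _|G _].
    exact: b_Theta2_form.
  exact: Lambda1_full.
apply: memv_otimes_map x1P => [F _|G _].
  exact: Lambda1_full.
exact: star0_form.
Qed.

Lemma b_Theta_hat_form (X : tensor K (8 + 2) 3) : b_Theta_hat X \in Lambda K (8 + 2) 3.
Proof. exact: (@duality_Lambda K (8 + 2) 3 0 (Theta_hat K) X). Qed.

Lemma b_Theta_hat_assemble (x : triple K) : in_summands x ->
  b_Theta_hat (assemble x) = assemble (block_operator x).
Proof.
case: x => -[x1 x2] x3 xP; have bxP := block_operator_in_summands xP.
have XL := assemble_form x1 x2 x3.
apply: three_form_eq => [||a b c|a b c|a b c].
- exact: b_Theta_hat_form.
- exact: assemble_form.
- rewrite b_Theta_hat_LLL // [RHS]assemble_LLL // [RHS]ffunE [otimes_map _ _ _ _]ffunE.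
  rewrite et_ThetaE /GRing.scale /= !mulr_sumr; apply: eq_bigr => i _.
  rewrite [fun_of_fin (finfun (fun i => star2 _ _)) _]ffunE star2E !mulr_sumr.
  apply: eq_bigr => e _.
  rewrite !mulr_sumr; apply: eq_bigr => f _.
  rewrite assemble_LRR // [fun_of_fin (finfun (fun j => x3 _)) _]ffunE.
  (* The factor 1/2! in [star2] turns the coefficient 6 into the 3 of [b_Theta_hat_LLL]. *)
  by field.
- rewrite b_Theta_hat_LLR // [RHS]assemble_LLR // [RHS]ffunE [otimes_map _ _ _ _]ffunE.
  rewrite b_Theta2E /GRing.scale /= !mulr_sumr; apply: eq_bigr => i _.
  rewrite !mulr_sumr; apply: eq_bigr => j _;
  rewrite [fun_of_fin (finfun (fun i => star1 _ _)) _]ffunE star1E !mulr_sumr.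
  apply: eq_bigr => e _.
  rewrite assemble_LLR // [fun_of_fin (finfun (fun j => x2 _)) _]ffunE.
  (* The operator contracts the first index of [epsilon] and [star1] the second; this swap is the
     minus sign of -3. *)
  rewrite (form_swap0 e) ?epsilon_form //.
  by ring.
rewrite b_Theta_hat_LRR // [RHS]assemble_LRR // [RHS]ffunE e_ThetaE.
do 3![apply: eq_bigr => ? _]; rewrite assemble_LLL // -mulrA.
rewrite [fun_of_fin (finfun (fun i => star0 _ _)) _]ffunE star0E.
by congr (_ * (_ * _)); rewrite ffunE.
Qed.
End Decomposition.

(** * Eigenspaces *)

Section Push.
Variables (K : numFieldType) (n N : nat) (f : 'I_n -> 'I_N).

Lemma push_form k (F : tensor K n k) : F \in Lambda K n k -> push f F \in Lambda K N k.
Proof.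
move=> FL; apply/LambdaP=> s t; rewrite !ffunE mulr_sumr.
have permK (m : nat) (u : 'rV['I_m]_k) : col_perm s^-1 (col_perm s u) = u.
  by rewrite -col_permM mulVg col_perm1.
rewrite (reindex_inj (can_inj (permK n))); apply: eq_big => [u|u _].
  by rewrite map_col_perm (inj_eq (can_inj (permK N))).
exact: form_perm.
Qed.

Lemma push_map k (F : tensor K n k) t : injective f -> push f F (map_mx f t) = F t.
Proof.
move=> f_inj; rewrite ffunE (eq_bigl (xpred1 t)) ?big_pred1_eq // => s /=.
apply/eqP/eqP=> [/rowP st|-> //]; apply/rowP=> i; apply: f_inj.
by have:= st i; rewrite !mxE.
Qed.
End Push.

(** * The eigenvalue equation in terms of the components A, B and D *)

Section Components.
Variable K : numFieldType.

Local Notation th a b c d := (Theta K (a ::: b ::: c ::: d ::: vnil)).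
Local Notation ep a b := (epsilon K (a ::: b ::: vnil)).

Implicit Type X : tensor K (8 + 2) 3.

Definition partA X : tensor K 8 3 := [ffun s => X (map_mx lo s)].
Definition partB X c : tensor K 8 2 :=
  [ffun s => X (row_mx (idx1 (hi c)) (map_mx lo s) : 'rV_(1 + 2))].
Definition partD X : tensor K 8 1 :=
  [ffun s => X (row_mx (map_mx lo s) (idx2 (hi 0) (hi 1)) : 'rV_(1 + 2))].

Lemma partAE X a b c : partA X (idx3 a b c) = X (idx3 (lo a) (lo b) (lo c)).
Proof. by rewrite ffunE !map_vcons map_vnil. Qed.

Lemma partBE X c a b : X \in Lambda K (8 + 2) 3 ->
  partB X c (idx2 a b) = X (idx3 (lo a) (lo b) (hi c)).
Proof.
move=> XL; rewrite ffunE !map_vcons map_vnil row_mx_vcons row_mx_nil.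
by rewrite [RHS]form_swap1 // [X in _ = - X]form_swap0 // opprK.
Qed.

Lemma partDE X a : partD X (idx1 a) = X (idx3 (lo a) (hi 0) (hi 1)).
Proof. by rewrite ffunE !map_vcons map_vnil row_mx_vcons row_mx_nil. Qed.

Lemma partA_form X : X \in Lambda K (8 + 2) 3 -> partA X \in Lambda K 8 3.
Proof. exact: pullback_form. Qed.

Lemma partB_form X c : X \in Lambda K (8 + 2) 3 -> partB X c \in Lambda K 8 2.
Proof.
move=> XL; have := pullback_form lo (@row_slice_form _ _ 1 2 X (idx1 (hi c)) XL).
rewrite (_ : finfun _ = partB X c) //.
by apply/ffunP=> t; rewrite !ffunE.
Qed.

Lemma sum_ord2 (M : nmodType) (f : 'I_2 -> M) : \sum_i f i = f 0 + f 1.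
Proof. by rewrite big_ord_recl big_ord1; congr (_ + f _); apply: val_inj. Qed.

Lemma ord2E (c : 'I_2) : c = 0 \/ c = 1.
Proof. by case: c => -[|[|//]] ?; [left | right]; apply: val_inj. Qed.

Lemma parts_eq X Y : X \in Lambda K (8 + 2) 3 -> Y \in Lambda K (8 + 2) 3 ->
  partA X = partA Y -> partB X 0 = partB Y 0 -> partB X 1 = partB Y 1 ->
  partD X = partD Y -> X = Y.
Proof.
move=> XL YL eqA eqB0 eqB1 eqD; apply: three_form_eq => // a b c.
- by rewrite -!partAE eqA.
- by rewrite -!partBE //; case: (ord2E c) => ->; rewrite ?eqB0 ?eqB1.
case: (ord2E b) (ord2E c) => -> [] ->; rewrite ?form_repeat1 // -?partDE ?eqD //.
by rewrite form_swap1 // -partDE eqD partDE -form_swap1.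
Qed.

Lemma partA_b_Theta_hat X : X \in Lambda K (8 + 2) 3 ->
  partA (b_Theta_hat X) = 6 *: et_Theta (partD X).
Proof.
move=> XL; apply/eqP; rewrite -subr_eq0; apply/eqP.
apply: three_form_eq0 => [|a b c _].
  by rewrite memvB ?memvZ ?et_Theta_form // partA_form // b_Theta_hat_form.
rewrite [LHS]ffunE [X in _ + X]ffunE [X in - X]ffunE partAE b_Theta_hat_LLL // et_ThetaE.
apply/eqP; rewrite subr_eq0; apply/eqP; rewrite /GRing.scale /= !mulr_sumr.
apply: eq_bigr => i _; rewrite !sum_ord2 !epsilonE partDE.
rewrite [X (idx3 _ (hi 1) (hi 0))]form_swap1 //; ring.
Qed.

Lemma partB0_b_Theta_hat X : X \in Lambda K (8 + 2) 3 ->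
  partB (b_Theta_hat X) 0 = - 3 *: b_Theta2 (partB X 1).
Proof.
move=> XL; apply: tensor2_eq => a b; rewrite partBE ?b_Theta_hat_form //.
rewrite b_Theta_hat_LLR // [RHS]ffunE b_Theta2E /GRing.scale /= !mulr_sumr.
apply: eq_bigr => i _; rewrite !mulr_sumr; apply: eq_bigr => j _.
by rewrite partBE // sum_ord2 !epsilonE; ring.
Qed.

Lemma partB1_b_Theta_hat X : X \in Lambda K (8 + 2) 3 ->
  partB (b_Theta_hat X) 1 = 3 *: b_Theta2 (partB X 0).
Proof.
move=> XL; apply: tensor2_eq => a b; rewrite partBE ?b_Theta_hat_form //.
rewrite b_Theta_hat_LLR // [RHS]ffunE b_Theta2E /GRing.scale /= !mulr_sumr.
apply: eq_bigr => i _; rewrite !mulr_sumr; apply: eq_bigr => j _.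
by rewrite partBE // sum_ord2 !epsilonE; ring.
Qed.

Lemma partD_b_Theta_hat X : X \in Lambda K (8 + 2) 3 ->
  partD (b_Theta_hat X) = e_Theta (partA X).
Proof.
move=> XL; apply: tensor1_eq => a; rewrite partDE b_Theta_hat_LRR // e_ThetaE.
by do 3![apply: eq_bigr => ? _]; rewrite partAE epsilonE mulr1.
Qed.

(** The equation splits into two independent systems, one for A and D and one for the two B
    components, which the operator rotates into each other up to the factor 3 b. *)
Lemma eigen_hatP l X : reflect
  [/\ X \in Lambda K (8 + 2) 3, 6 *: et_Theta (partD X) = l *: partA X,
      - 3 *: b_Theta2 (partB X 1) = l *: partB X 0,
      3 *: b_Theta2 (partB X 0) = l *: partB X 1 &
      e_Theta (partA X) = l *: partD X]
  (X \in form_eigenspace (@b_Theta_hat K) l).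
Proof.
have pA : partA (l *: X) = l *: partA X by apply/ffunP=> t; rewrite !ffunE.
have pB c : partB (l *: X) c = l *: partB X c by apply/ffunP=> t; rewrite !ffunE.
have pD : partD (l *: X) = l *: partD X by apply/ffunP=> t; rewrite !ffunE.
apply: (iffP (form_eigenspaceP _ _ _)) => [[XL bX] | [XL eqA eqB0 eqB1 eqD]].
  rewrite -pA -!pB -pD -bX; split=> //.
  - by rewrite partA_b_Theta_hat.
  - by rewrite partB0_b_Theta_hat.
  - by rewrite partB1_b_Theta_hat.
  by rewrite partD_b_Theta_hat.
split=> //; apply: parts_eq; rewrite ?b_Theta_hat_form ?memvZ ?pA ?pB ?pD //.
- by rewrite partA_b_Theta_hat.
- by rewrite partB0_b_Theta_hat.
- by rewrite partB1_b_Theta_hat.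
by rewrite partD_b_Theta_hat.
Qed.
End Components.

Section Eigenspaces.
Variable K : numFieldType.

Local Notation E l := (form_eigenspace (@b_Theta_hat K) l).
Local Notation L2 b := (form_eigenspace (@b_Theta2 K) b).
Local Notation L3 b := (form_eigenspace (@b_Theta3 K) b).

Lemma incl8_form k (A : tensor K 8 k) : A \in Lambda K 8 k -> incl8 A \in Lambda K (8 + 2) k.
Proof. exact: push_form. Qed.

Lemma incl8_eq0 k (A : tensor K 8 k) t : lcount t != k -> incl8 A t = 0.
Proof.
move=> t_k; rewrite ffunE big_pred0 // => s; apply: contraNF t_k => /eqP <-.
by rewrite lcount_lshift.
Qed.

Section PartsOfInclusion.
Variable A : tensor K 8 3.
Hypothesis AL : A \in Lambda K 8 3.

Lemma partA_incl8 : partA (incl8 A) = A.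
Proof. by apply/ffunP=> s; rewrite ffunE push_map //; apply: lshift_inj. Qed.

Lemma partB_incl8 c : partB (incl8 A) c = 0.
Proof.
apply: tensor2_eq => a b; rewrite partBE ?incl8_form // [RHS]ffunE.
by rewrite incl8_eq0 // !lcount_vconsE.
Qed.

Lemma partD_incl8 : partD (incl8 A) = 0.
Proof.
by apply: tensor1_eq => a; rewrite partDE [RHS]ffunE incl8_eq0 // !lcount_vconsE.
Qed.
End PartsOfInclusion.

Section PartsOfMixed.
Variables (F : tensor K 8 2) (V : tensor K 2 1).
Hypothesis FL : F \in Lambda K 8 2.
Let X : tensor K (8 + 2) 3 := to_wedge (otimes F V).

Let XL : X \in Lambda K (8 + 2) 3. Proof. exact: (to_wedge_form (otimes F V)). Qed.

Lemma partA_mixed : partA X = 0.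
Proof.
apply/ffunP=> s; rewrite !ffunE; apply: (@to_wedge_eq0 K 2 1).
by rewrite lcount_lshift.
Qed.

Lemma partB_mixed c : partB X c = V (idx1 c) *: F.
Proof.
apply: tensor2_eq => a b; rewrite partBE // [RHS]ffunE.
have FV : otimes F V \in LambdaLambda K 2 1 by apply: memv_otimes (Lambda1_full V).
have := to_wedge_row (idx2 a b) (idx1 c) FV.
by rewrite !map_vcons !map_vnil !row_mx_vcons row_mx_nil ffunE => ->; apply: mulrC.
Qed.

Lemma partD_mixed : partD X = 0.
Proof.
apply: tensor1_eq => a; rewrite partDE [RHS]ffunE; apply: (@to_wedge_eq0 K 2 1).
by rewrite !lcount_vconsE.
Qed.
End PartsOfMixed.

Section PartsOfTop.
Variable D : tensor K 8 1.
Let X : tensor K (8 + 2) 3 := wedge (incl8 D) (incl2 (epsilon K)).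
Let XE : X = to_wedge (otimes D (epsilon K)) :> tensor K (8 + 2) (1 + 2).
Proof. by rewrite to_wedge_otimes. Qed.

Lemma top_form : X \in Lambda K (8 + 2) 3.
Proof. by rewrite XE; exact: (to_wedge_form (otimes D (epsilon K))). Qed.

Lemma partA_top : partA X = 0.
Proof.
apply/ffunP=> s; rewrite [LHS]ffunE [RHS]ffunE XE; apply: (@to_wedge_eq0 K 1 2).
by rewrite lcount_lshift.
Qed.

Lemma partB_top c : partB X c = 0.
Proof.
apply: tensor2_eq => a b; rewrite partBE ?top_form // [RHS]ffunE XE.
by apply: (@to_wedge_eq0 K 1 2); rewrite !lcount_vconsE.
Qed.

Lemma partD_top : partD X = D.
Proof.
apply: tensor1_eq => a; rewrite partDE XE.
have DV : otimes D (epsilon K) \in LambdaLambda K 1 2.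
  by apply: memv_otimes (Lambda1_full D) (epsilon_form K).
have := to_wedge_row (idx1 a) (idx2 0 1) DV.
by rewrite !map_vcons !map_vnil !row_mx_vcons row_mx_nil ffunE epsilon01 mulr1 => ->.
Qed.
End PartsOfTop.

Lemma partAD X Y : partA (X + Y) = partA X + partA Y :> tensor K 8 3.
Proof. by apply/ffunP=> t; rewrite !ffunE. Qed.
Lemma partBD X Y c : partB (X + Y) c = partB X c + partB Y c :> tensor K 8 2.
Proof. by apply/ffunP=> t; rewrite !ffunE. Qed.
Lemma partDD X Y : partD (X + Y) = partD X + partD Y :> tensor K 8 1.
Proof. by apply/ffunP=> t; rewrite !ffunE. Qed.

(* b_Theta3 = 2/3 + et_Theta o e_Theta / 9, and e_Theta o et_Theta = -42. *)
Lemma L3P A : reflect (A \in Lambda K 8 3 /\ e_Theta A = 0) (A \in L3 (2 / 3)).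
Proof.
apply: (iffP (form_eigenspaceP _ _ _)) => /= -[AL]; last first.
  by move=> eA; rewrite b_Theta3_et_e // eA linear0 scaler0 addr0.
move=> bA; split=> //.
have : 9^-1 *: et_Theta (e_Theta A) = 0.
  by apply: (addrI (2 / 3 *: A)); rewrite -b_Theta3_et_e // bA addr0.
move/(congr1 (@e_Theta K)); rewrite linearZ /= e_Theta_et linear0 scalerA => /eqP.
by rewrite scaler_eq0 mulf_eq0 invr_eq0 oppr_eq0 !pnatr_eq0 => /eqP.
Qed.

Lemma e_Theta_onto : (linfun (@e_Theta K) @: Lambda K 8 3)%VS = fullv.
Proof.
apply/vspaceP=> D; rewrite memvf; apply/memv_imgP.
exists ((- 42)^-1 *: et_Theta D); first by rewrite memvZ ?et_Theta_form.
by rewrite lfunE linearZ /= e_Theta_et scalerA mulVf ?scale1r // oppr_eq0 pnatr_eq0.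
Qed.

(** By [L3P] this is the kernel of [e_Theta] on three-forms; as [e_Theta] is onto, rank and nullity
    give 56 - 8. *)
Lemma dim_L3 : \dim (L3 (2 / 3)) = 48%N.
Proof.
have := limg_ker_dim (linfun (@e_Theta K)) (Lambda K 8 3).
rewrite e_Theta_onto dim_ffun card_mx card_ord dim_Lambda => dims.
have -> : L3 (2 / 3) = (Lambda K 8 3 :&: lker (linfun (@e_Theta K)))%VS.
  apply/vspaceP=> A; apply/L3P/memv_capP => -[AL eA]; split=> //.
    by rewrite memv_ker lfunE; apply/eqP.
  by move: eA; rewrite memv_ker lfunE => /eqP.
by move: dims; rewrite (_ : 'C(8, 3) = 48 + 8)%N // => /addIn.
Qed.

(** At eigenvalue 0, et D = 0 forces D = 0 because e et = -42, and b B = 0 forces B = 0 because b^2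
    = 12 - 4 b. What remains is e A = 0, which [L3P] identifies. *)
Lemma eigenspace_0 : E 0 = (linfun (@incl8 K 3) @: L3 (2 / 3))%VS.
Proof.
apply/vspaceP=> X; apply/eigen_hatP/memv_imgP => [[XL] | [A]].
  rewrite !scale0r => eqA eqB0 eqB1 eqD.
  have D0 : partD X = 0.
    have := congr1 (@e_Theta K) eqA; rewrite linearZ /= e_Theta_et linear0 scalerA.
    by move/eqP; rewrite scaler_eq0 mulf_eq0 oppr_eq0 !pnatr_eq0 => /eqP.
  have B0 c : partB X c = 0.
    have bB : b_Theta2 (partB X c) = 0.
      case: (ord2E c) => ->; apply/eqP.
        by move/eqP: eqB1; rewrite scaler_eq0 pnatr_eq0.
      by move/eqP: eqB0; rewrite scaler_eq0 oppr_eq0 pnatr_eq0.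
    have := b_Theta2_b (partB_form c XL); rewrite bB linear0 scaler0 subr0 => /esym/eqP.
    by rewrite scaler_eq0 pnatr_eq0 => /eqP.
  have AL := partA_form XL; exists (partA X); first exact/L3P.
  rewrite lfunE; apply: parts_eq; rewrite ?incl8_form //.
  - by rewrite partA_incl8.
  - by rewrite partB_incl8 ?B0.
  - by rewrite partB_incl8 ?B0.
  by rewrite partD_incl8.
move=> /L3P[AL eA] ->; rewrite lfunE /=.
split; rewrite ?incl8_form // ?partA_incl8 ?partB_incl8 ?partD_incl8 //.
- by rewrite linear0 scaler0 scale0r.
- by rewrite linear0 !scaler0.
- by rewrite linear0 !scaler0.
by rewrite eA scaler0.
Qed.

Lemma dim_eigenspace_0 : \dim (E 0) = 48%N.
Proof.
rewrite eigenspace_0 limg_dim_inj ?dim_L3 // => A /L3P[AL _]; rewrite lfunE => A0.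
by rewrite -(partA_incl8 A) [incl8 A]A0; apply/ffunP=> t; rewrite !ffunE.
Qed.
End Eigenspaces.

(** * Restrictions on eigenvalues, and the eigenspaces of mixed type *)

Section NonzeroEigenvalues.
Variable K : numFieldType.

Local Notation E l := (form_eigenspace (@b_Theta_hat K) l).
Local Notation L2 b := (form_eigenspace (@b_Theta2 K) b).
Local Notation Rs t := (form_eigenspace (@star1 K) t).

Lemma partD_eigen l X : X \in E l -> (partD X == 0) || (l * l == - 252).
Proof.
move=> /eigen_hatP[_ eqA _ _ eqD].
have /eqP: (l * l) *: partD X = (- 252) *: partD X.
  have := congr1 (@e_Theta K) eqA; rewrite !linearZ /= e_Theta_et eqD !scalerA => <-.
  by congr (_ *: _); ring.
by rewrite -subr_eq0 -scalerBl scaler_eq0 subr_eq0 orbC.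
Qed.

(* B_0 + t B_1 is mapped to 3 t b_Theta (B_0 + t B_1). *)
Lemma partB_eigen l t X : t * t = -1 -> X \in E l ->
  [\/ partB X 0 + t *: partB X 1 = 0, l = 6 * t | l = - 18 * t].
Proof.
move=> tt /eigen_hatP[XL _ eqB0 eqB1 _]; set W := _ + _.
have [->|W0] := eqVneq W 0; first by constructor 1.
have WL : W \in Lambda K 8 2 by rewrite memvD ?memvZ ?partB_form.
have bB1 : b_Theta2 (partB X 1) = - (l / 3) *: partB X 0.
  apply: (@scalerI _ _ (- 3)); first by rewrite oppr_eq0 pnatr_eq0.
  by rewrite eqB0 scalerA; congr (_ *: _); field.
have bB0 : b_Theta2 (partB X 0) = l / 3 *: partB X 1.
  apply: (@scalerI _ _ 3); first by rewrite pnatr_eq0.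
  by rewrite eqB1 scalerA; congr (_ *: _); field.
have bW : b_Theta2 W = - (l * t / 3) *: W.
  rewrite linearD linearZ /= bB0 bB1 scalerDr !scalerA addrC.
  congr (_ *: _ + _ *: _); first by ring.
  by rewrite -[LHS]mulr1 -[1]opprK -tt; ring.
have lE : l = - (l * t) * t by rewrite -[LHS]mulr1 -[1]opprK -tt; ring.
have ltE : - (l * t) = 3 * - (l * t / 3) by field.
case/orP: (b_Theta2_eigenvalue WL bW W0) => /eqP lt; [constructor 2 | constructor 3];
  rewrite [LHS]lE; congr (_ * _).
  by rewrite ltE lt; ring.
by rewrite ltE lt; ring.
Qed.

Section Mixed.
Variables (b t : K).
Hypothesis tt : t * t = -1.
Hypothesis b_eigen : (b == 2) || (b == -6).

Let tn0 : t != 0.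
Proof. by apply/eqP=> t0; move/eqP: tt; rewrite t0 mul0r eq_sym oppr_eq0 oner_eq0. Qed.

(** The vector e_9 + t e_10, which spans the t-eigenline of the rotation [star1]. *)
Definition star1_vector : tensor K 2 1 := [ffun c : 'rV_1 => if c 0 0 == 0 then 1 else t].

Lemma star1_vector0 : star1_vector (idx1 0) = 1.
Proof. by rewrite ffunE vcons0. Qed.

Lemma star1_vector1 : star1_vector (idx1 1) = t.
Proof. by rewrite ffunE vcons0. Qed.

Lemma star1_eigenP (V : tensor K 2 1) : reflect (V (idx1 1) = t * V (idx1 0)) (V \in Rs t).
Proof.
have star0 : star1 V (idx1 0) = V (idx1 1).
  by rewrite star1E sum_ord2 !epsilonE mul0r mul1r add0r.
have star1 : star1 V (idx1 1) = - V (idx1 0).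
  by rewrite star1E sum_ord2 !epsilonE mul0r mulN1r addr0.
apply: (iffP (form_eigenspaceP _ _ _)) => /= [[_ sV] | V1].
  by rewrite -star0 sV scale_tensorE.
split; first exact: Lambda1_full.
apply: tensor1_eq => c; rewrite scale_tensorE; case: (ord2E c) => ->.
  by rewrite star0.
by rewrite star1 V1 mulrA tt mulN1r.
Qed.

Lemma star1_vector_eigen : star1_vector \in Rs t.
Proof. by apply/star1_eigenP; rewrite star1_vector0 star1_vector1 mulr1. Qed.

Lemma mixed_eigen F V : F \in L2 b -> V \in Rs t ->
  (to_wedge (otimes F V) : tensor K (8 + 2) 3) \in E (- 3 * b * t).
Proof.
move=> /form_eigenspaceP[/= FL bF] /star1_eigenP V1; apply/eigen_hatP; split.
- exact: (to_wedge_form (otimes F V)).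
- by rewrite partA_mixed partD_mixed // linear0 !scaler0.
- rewrite !partB_mixed // linearZ /= bF !scalerA V1; congr (_ *: _); ring.
- rewrite !partB_mixed // linearZ /= bF !scalerA V1; congr (_ *: _).
  by rewrite -[LHS]mulr1 -[1]opprK -tt; ring.
by rewrite partA_mixed partD_mixed // linear0 scaler0.
Qed.

Lemma eigen_mixed X : X \in E (- 3 * b * t) ->
  partB X 0 \in L2 b /\ X = to_wedge (otimes (partB X 0) star1_vector).
Proof.
move=> XE; have /eigen_hatP[XL eqA eqB0 eqB1 eqD] := XE.
(* The square is -36 for b = 2 and -324 for b = -6, so [partD_eigen] leaves only D = 0. *)
have l2 : (- 3 * b * t) * (- 3 * b * t) != - 252.
  have -> : (- 3 * b * t) * (- 3 * b * t) = 9 * b * b * (t * t) by ring.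
  rewrite tt -subr_eq0; case/orP: b_eigen => /eqP ->.
    by rewrite (_ : _ - _ = 216%:R) ?pnatr_eq0 //; ring.
  by rewrite (_ : _ - _ = - 72%:R) ?oppr_eq0 ?pnatr_eq0 //; ring.
have D0 : partD X = 0 by have := partD_eigen XE; rewrite (negPf l2) orbF => /eqP.
have b0 : b != 0 by case/orP: b_eigen => /eqP ->; rewrite ?oppr_eq0 pnatr_eq0.
have A0 : partA X = 0.
  apply/eqP; move/esym/eqP: eqA; rewrite D0 linear0 scaler0 scaler_eq0.
  by rewrite !mulf_eq0 oppr_eq0 pnatr_eq0 (negPf b0) (negPf tn0).
(* A nonzero combination would have eigenvalue 6 t or -18 t, whereas -3 b t is -6 t or 18 t; the
   four differences are the constants below. *)
have W0 : partB X 0 + t *: partB X 1 = 0.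
  case: (partB_eigen tt XE) => // /(mulIf tn0)/eqP; rewrite -subr_eq0;
    case/orP: b_eigen => /eqP ->.
  - by rewrite (_ : _ - _ = - 12%:R) ?oppr_eq0 ?pnatr_eq0 //; ring.
  - by rewrite (_ : _ - _ = 12%:R) ?pnatr_eq0 //; ring.
  - by rewrite (_ : _ - _ = 12%:R) ?pnatr_eq0 //; ring.
  by rewrite (_ : _ - _ = 36%:R) ?pnatr_eq0 //; ring.
have B1 : partB X 1 = t *: partB X 0.
  have : t *: (partB X 0 + t *: partB X 1) = 0 by rewrite W0 scaler0.
  by rewrite scalerDr scalerA tt scaleN1r => /eqP; rewrite subr_eq0 => /eqP.
have B0L : partB X 0 \in Lambda K 8 2 by apply: partB_form.
split.
  apply/form_eigenspaceP; split=> //=.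
  apply: (@scalerI _ _ 3); first by rewrite pnatr_eq0.
  rewrite eqB1 B1 !scalerA; congr (_ *: _).
  by rewrite -[RHS]mulr1 -[1]opprK -tt; ring.
apply: parts_eq => //.
- exact: (to_wedge_form (otimes (partB X 0) star1_vector)).
- by rewrite partA_mixed.
- by rewrite partB_mixed // star1_vector0 scale1r.
- by rewrite partB_mixed // star1_vector1.
by rewrite partD_mixed.
Qed.

Definition mixed (F : tensor K 8 2) : tensor K (8 + 2) 3 := to_wedge (otimes F star1_vector).

Fact mixed_is_linear : linear mixed.
Proof.
move=> a F G; have := @to_wedge_is_linear K 2 1 a (otimes F star1_vector)
  (otimes G star1_vector).
suff -> : a *: otimes F star1_vector + otimes G star1_vector =
  otimes (a *: F + G) star1_vector by [].
by apply/ffunP=> z; rewrite !ffunE /GRing.scale /=; ring.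
Qed.
HB.instance Definition _ := GRing.isLinear.Build K (tensor K 8 2)
  (tensor K (8 + 2) 3) _ mixed mixed_is_linear.

Lemma eigenspace_mixed : E (- 3 * b * t) =
  (linfun (@to_wedge K 2 1) @: otimesv (L2 b) (Rs t))%VS.
Proof.
apply/vspaceP=> X; apply/idP/idP=> [/eigen_mixed[B0L ->] | ].
  rewrite -[to_wedge _]lfunE; apply: memv_img; exact: memv_otimes star1_vector_eigen.
move=> /memv_imgP[T TL ->].
suff: (otimesv (L2 b) (Rs t) <= linfun (@to_wedge K 2 1) @^-1: E (- 3 * b * t))%VS.
  by move/subvP/(_ T TL); rewrite -memv_preim.
apply: otimesv_ind => F V FL VR; rewrite -memv_preim lfunE; exact: mixed_eigen.
Qed.

(** The eigenspace of [star1] is a line, so wedging with [star1_vector] identifies [L2 b] with the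
    whole eigenspace; the component [partB _ 0] recovers the two-form. *)
Lemma dim_eigenspace_mixed : \dim (E (- 3 * b * t)) = \dim (L2 b).
Proof.
have -> : E (- 3 * b * t) = (linfun mixed @: L2 b)%VS.
  apply/vspaceP=> X; apply/idP/memv_imgP=> [/eigen_mixed[B0L XE] | [F FL ->]].
    by exists (partB X 0); rewrite // lfunE.
  by rewrite lfunE; apply: mixed_eigen star1_vector_eigen.
apply: limg_dim_inj => F /form_eigenspaceP[FL _]; rewrite lfunE => X0.
rewrite -[F]scale1r -star1_vector0 -partB_mixed // -/(mixed F) [mixed F]X0.
by apply/ffunP=> s; rewrite !ffunE.
Qed.
End Mixed.
End NonzeroEigenvalues.

Fact partD_is_linear (K : numFieldType) : linear (@partD K).
Proof. by move=> a X Y; apply/ffunP=> s; rewrite !ffunE. Qed.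
HB.instance Definition _ (K : numFieldType) := GRing.isLinear.Build K
  (tensor K (8 + 2) 3) (tensor K 8 1) _ (@partD K) (@partD_is_linear K).

Lemma add_sub_eq0 (K : numFieldType) (V : lmodType K) (t : K) (v w : V) :
  t != 0 -> v + t *: w = 0 -> v + - t *: w = 0 -> v = 0 /\ w = 0.
Proof.
move=> t0 vw vw'; have v0 : v = 0.
  apply: (@scalerI _ _ 2); first by rewrite pnatr_eq0.
  rewrite scaler0 -[RHS]addr0 -{1}vw -vw' addrACA -scalerDl subrr scale0r addr0.
  by rewrite scaler_nat.
by split=> //; move/eqP: vw; rewrite v0 add0r scaler_eq0 (negPf t0) => /eqP.
Qed.

(** * The eigenspaces with D nonzero, for eigenvalues of square -252 *)

Section TopEigenspace.
Variables (K : numFieldType) (l t : K).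
Hypothesis tt : t * t = -1.
Hypothesis ll : l * l = - 252.

Local Notation E l := (form_eigenspace (@b_Theta_hat K) l).

Let ln0 : l != 0.
Proof.
apply/eqP=> l0; move/eqP: ll; rewrite l0 mul0r eq_sym oppr_eq0.
by rewrite pnatr_eq0.
Qed.

(** The coefficient 6 / l is forced by the equation 6 et D = l A. *)
Definition top_eigenvector (D : tensor K 8 1) : tensor K (8 + 2) 3 :=
  incl8 (6 / l *: et_Theta D)
  + (wedge (incl8 D) (incl2 (epsilon K)) : tensor K (8 + 2) 3).

Lemma top_eigenvector_form D : top_eigenvector D \in Lambda K (8 + 2) 3.
Proof. by rewrite memvD ?top_form // incl8_form // memvZ // et_Theta_form. Qed.

Let etL D : 6 / l *: et_Theta D \in Lambda K 8 3.
Proof. by rewrite memvZ ?et_Theta_form. Qed.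

Lemma partA_top_eigenvector D : partA (top_eigenvector D) = 6 / l *: et_Theta D.
Proof. by rewrite partAD partA_top addr0 partA_incl8. Qed.

Lemma partB_top_eigenvector D c : partB (top_eigenvector D) c = 0.
Proof. by rewrite partBD partB_top addr0 partB_incl8. Qed.

Lemma partD_top_eigenvector D : partD (top_eigenvector D) = D.
Proof. by rewrite partDD partD_top partD_incl8 add0r. Qed.

Lemma top_eigenP X : reflect (exists D, X = top_eigenvector D) (X \in E l).
Proof.
have t0 : t != 0.
  by apply/eqP=> t0; move/eqP: tt; rewrite t0 mul0r eq_sym oppr_eq0 oner_eq0.
apply: (iffP idP) => [XE | [D ->]]; last first.
  apply/eigen_hatP; split; first exact: top_eigenvector_form.
  - rewrite partA_top_eigenvector partD_top_eigenvector scalerA; congr (_ *: _).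
    by rewrite mulrC divfK.
  - by rewrite !partB_top_eigenvector linear0 !scaler0.
  - by rewrite !partB_top_eigenvector linear0 !scaler0.
  rewrite partA_top_eigenvector partD_top_eigenvector linearZ /= e_Theta_et scalerA.
  congr (_ *: _); apply: (mulIf ln0); rewrite ll mulrAC divfK //; ring.
exists (partD X); have /eigen_hatP[XL eqA _ _ _] := XE.
(* The alternatives 6 u and -18 u have squares -36 and -324, not -252. Applied to u = t and u = -t,
   this kills both components B. *)
have W0 u : u * u = -1 -> partB X 0 + u *: partB X 1 = 0.
  move=> uu; case: (partB_eigen uu XE) => // lE; move/eqP: ll; rewrite -subr_eq0 lE.
    have -> : 6 * u * (6 * u) - -252 = 36 * (u * u) + 252 by ring.
    by rewrite uu (_ : _ + _ = 216%:R) ?pnatr_eq0 //; ring.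
  have -> : -18 * u * (-18 * u) - -252 = 324 * (u * u) + 252 by ring.
  by rewrite uu (_ : _ + _ = - 72%:R) ?oppr_eq0 ?pnatr_eq0 //; ring.
have W := W0 t tt; have W' : partB X 0 + - t *: partB X 1 = 0 by apply: W0; rewrite mulrNN.
have [B0 B1] := add_sub_eq0 t0 W W'.
apply: parts_eq => //; first exact: top_eigenvector_form.
- rewrite partA_top_eigenvector; apply: (scalerI ln0).
  by rewrite -eqA scalerA mulrC divfK.
- by rewrite partB_top_eigenvector.
- by rewrite partB_top_eigenvector.
by rewrite partD_top_eigenvector.
Qed.

Lemma dim_top_eigenspace : \dim (E l) = 8%N.
Proof.
rewrite -(@limg_dim_inj _ _ _ (linfun (@partD K))).
  rewrite (_ : lfun_img _ _ = fullv); first by rewrite dim_ffun card_mx card_ord.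
  apply/vspaceP=> D; rewrite memvf; apply/memv_imgP.
  exists (top_eigenvector D); first by apply/top_eigenP; exists D.
  by rewrite lfunE /= partD_top_eigenvector.
move=> X /top_eigenP[D ->]; rewrite lfunE /= partD_top_eigenvector => ->.
apply: parts_eq; rewrite ?mem0v ?top_eigenvector_form //.
- by rewrite partA_top_eigenvector linear0 scaler0; apply/ffunP=> s; rewrite !ffunE.
- by rewrite partB_top_eigenvector; apply/ffunP=> s; rewrite !ffunE.
- by rewrite partB_top_eigenvector; apply/ffunP=> s; rewrite !ffunE.
by rewrite partD_top_eigenvector; apply/ffunP=> s; rewrite !ffunE.
Qed.
End TopEigenspace.

(** * The complete spectrum, given square roots of -1 and 7 *)

Section Spectrum.
Variables (K : numFieldType) (i r : K).
Hypothesis ii : i * i = -1.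
Hypothesis rr : r * r = 7.

Local Notation E l := (form_eigenspace (@b_Theta_hat K) l).
Local Notation L2 b := (form_eigenspace (@b_Theta2 K) b).
Local Notation L3 b := (form_eigenspace (@b_Theta3 K) b).
Local Notation R_ s := (form_eigenspace (@star1 K) (s * i)).

Let i0 : i != 0.
Proof. by apply/eqP=> t0; move/eqP: ii; rewrite t0 mul0r eq_sym oppr_eq0 oner_eq0. Qed.

Let r0 : r != 0.
Proof. by apply/eqP=> t0; move/eqP: rr; rewrite t0 mul0r eq_sym pnatr_eq0. Qed.

Let sgn (s : K) : s \in [:: 1; -1] -> s * s = 1.
Proof. by rewrite !inE => /orP[]/eqP->; rewrite ?mulrNN mulr1. Qed.

Lemma eigenspace_18 (s : K) : s \in [:: 1; -1] ->
  E (s * (18%:R * i)) = (linfun (@to_wedge K 2 1) @: otimesv (L2 (- 6%:R)) (R_ s))%VS /\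
  \dim (E (s * (18%:R * i))) = 7%N.
Proof.
move=> /sgn ss; have tt : (s * i) * (s * i) = -1 by rewrite mulrACA ss ii mul1r.
have -> : s * (18%:R * i) = - 3 * (- 6) * (s * i) by ring.
have b6 : (- 6 == 2 :> K) || (- 6 == - 6 :> K) by rewrite eqxx orbT.
rewrite dim_eigenspace_mixed // (eigenspace_mixed tt) //; split=> //.
by case: (dim_eigenspaces2 K).
Qed.

(** Since 6 s i = -3 * 2 * (- s i), the root taken in [eigenspace_mixed] is t = - s i, which is why
    the signs cross here but not in [eigenspace_18]. *)
Lemma eigenspace_6 (s : K) : s \in [:: 1; -1] ->
  E (s * (6%:R * i)) = (linfun (@to_wedge K 2 1) @: otimesv (L2 2%:R) (R_ (- s)))%VS /\
  \dim (E (s * (6%:R * i))) = 21%N.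
Proof.
move=> /sgn ss; have tt : (- s * i) * (- s * i) = -1 by rewrite mulrACA mulrNN ss ii mul1r.
have -> : s * (6%:R * i) = - 3 * 2 * (- s * i) by ring.
have b2 : (2 == 2 :> K) || (2 == - 6 :> K) by rewrite eqxx.
rewrite dim_eigenspace_mixed // (eigenspace_mixed tt) //; split=> //.
by case: (dim_eigenspaces2 K).
Qed.

Lemma top_square s : s \in [:: 1; -1] ->
  (s * (6%:R * r * i)) * (s * (6%:R * r * i)) = - 252.
Proof.
move=> /sgn ss; transitivity (36 * (s * s) * (r * r) * (i * i)); first by ring.
by rewrite ss rr ii; ring.
Qed.

Lemma eigenspace_6_sqrt7 (s : K) : s \in [:: 1; -1] ->
  (forall X : tensor K (8 + 2) 3, X \in E (s * (6%:R * r * i)) <->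
     exists2 F : tensor K 8 1, F \in Lambda K 8 1 &
       X = incl8 ((- s * (i / r)) *: et_Theta F)
           + (wedge (incl8 F) (incl2 (epsilon K)) : tensor K (8 + 2) 3)) /\
  \dim (E (s * (6%:R * r * i))) = 8%N.
Proof.
move=> s1; have ll := top_square s1; split; last exact: (dim_top_eigenspace ii ll).
have ss := sgn s1; have s0 : s != 0.
  by apply/eqP=> s0; move/eqP: ss; rewrite s0 mul0r eq_sym oner_eq0.
(* The coefficient of [top_eigenvector] takes the stated form because s^2 = 1 and i^2 = -1. *)
have lE : - s * (i / r) = 6 / (s * (6%:R * r * i)).
  have l0 : s * (6%:R * r * i) != 0 by rewrite !mulf_neq0 // pnatr_eq0.
  apply: (mulIf l0); rewrite divfK //.
  transitivity (- 6 * (s * s) * (i * i)); last by rewrite ss ii; ring.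
  by field.
move=> X; rewrite lE; split=> [/(top_eigenP ii ll)[D ->] | [D _ ->]].
  by exists D; first exact: Lambda1_full.
by apply/(top_eigenP ii ll); exists D.
Qed.

(** For an eigenvector, D nonzero forces a^2 = -252, and a nonzero combination of the two B
    components with root i or - i forces one of the four mixed values. If all of these vanish, the
    first block equation becomes a A = 0 with A nonzero. *)
Lemma spectrum a : E a != 0%VS <->
  a \in [:: 0; 18%:R * i; - (18%:R * i); 6%:R * i; - (6%:R * i);
            6%:R * r * i; - (6%:R * r * i)].
Proof.
have dim_neq0 b : (0 < \dim (E b))%N -> E b != 0%VS by rewrite lt0n dimv_eq0.
have s1 : (1 : K) \in [:: 1; -1] by rewrite inE eqxx.
have sN1 : (-1 : K) \in [:: 1; -1] by rewrite !inE eqxx orbT.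
split=> [Ea0 | ]; last first.
  rewrite !inE => /or4P[|||/or4P[]] /eqP -> {a}; apply: dim_neq0.
  - by rewrite dim_eigenspace_0.
  - by have [_] := eigenspace_18 s1; rewrite mul1r => ->.
  - by have [_] := eigenspace_18 sN1; rewrite mulN1r => ->.
  - by have [_] := eigenspace_6 s1; rewrite mul1r => ->.
  - by have [_] := eigenspace_6 sN1; rewrite mulN1r => ->.
  - by have [_] := eigenspace_6_sqrt7 s1; rewrite mul1r => ->.
  by have [_] := eigenspace_6_sqrt7 sN1; rewrite mulN1r => ->.
have XE := memv_pick (E a); have X0 : vpick (E a) != 0 by rewrite vpick0.
move: (vpick _) XE X0 => X XE X0.
case/orP: (partD_eigen XE) => [/eqP D0 | aa]; last first.
  have := top_square s1; rewrite mul1r -(eqP aa) => /esym/eqP.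
  rewrite -!expr2 eqf_sqr => /orP[] /eqP ->; by rewrite !inE eqxx ?orbT.
have ii' : (- i) * (- i) = -1 by rewrite mulrNN.
case: (partB_eigen ii XE) => [W | -> | ->]; last first.
- by rewrite mulNr !inE eqxx !orbT.
- by rewrite !inE eqxx !orbT.
case: (partB_eigen ii' XE) => [W' | -> | ->]; last first.
- by rewrite mulrNN !inE eqxx !orbT.
- by rewrite mulrN !inE eqxx !orbT.
have [B0 B1] := add_sub_eq0 i0 W W'.
have /eigen_hatP[XL eqA _ _ _] := XE.
move/esym/eqP: eqA; rewrite D0 linear0 scaler0 scaler_eq0 => /orP[/eqP -> | /eqP A0].
  by rewrite inE eqxx.
case/eqP: X0; apply: parts_eq; rewrite ?mem0v //.
- by rewrite A0; apply/ffunP=> t; rewrite !ffunE.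
- by rewrite B0; apply/ffunP=> t; rewrite !ffunE.
- by rewrite B1; apply/ffunP=> t; rewrite !ffunE.
by rewrite D0 linear0.
Qed.
End Spectrum.

Theorem proposition3p11 (R : realType) :
  (* the decomposition of the three-forms *)
  ((forall x : triple R, in_summands x -> assemble x \in Lambda R (8 + 2) 3) /\
   (forall F : tensor R (8 + 2) 3, F \in Lambda R (8 + 2) 3 ->
      exists! x : triple R, in_summands x /\ assemble x = F)) /\
  (* the operator in block form *)
  (forall x : triple R, in_summands x ->
     in_summands (block_operator x) /\
     b_Theta_hat (assemble x) = assemble (block_operator x)) /\
  (* the eigenvalues and eigenspaces, in the complexification *)
  let C : fieldType := R[i] in
  let i : C := 'i%C in
  let sqrt7 : C := ((Num.sqrt (7%:R : R))%:C)%C in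
  let E (a : C) := form_eigenspace (@b_Theta_hat C) a in
  let L2 (a : C) := form_eigenspace (@b_Theta2 C) a in
  let L3 (a : C) := form_eigenspace (@b_Theta3 C) a in
  let R_ (s : C) := form_eigenspace (@star1 C) (s * i) in
  [/\ (forall a : C, E a != 0%VS <->
         a \in [:: 0; 18%:R * i; - (18%:R * i); 6%:R * i; - (6%:R * i);
                   6%:R * sqrt7 * i; - (6%:R * sqrt7 * i)]),
      E 0 = (linfun (@incl8 C 3) @: L3 (2%:R / 3%:R))%VS /\ \dim (E 0) = 48%N,
      (forall s : C, s \in [:: 1; -1] ->
         E (s * (18%:R * i)) =
           (linfun (@to_wedge C 2 1) @: otimesv (L2 (- 6%:R)) (R_ s))%VS /\
         \dim (E (s * (18%:R * i))) = 7%N),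
      (forall s : C, s \in [:: 1; -1] ->
         E (s * (6%:R * i)) =
           (linfun (@to_wedge C 2 1) @: otimesv (L2 2%:R) (R_ (- s)))%VS /\
         \dim (E (s * (6%:R * i))) = 21%N)
    & (forall s : C, s \in [:: 1; -1] ->
         (forall X : tensor C (8 + 2) 3,
            X \in E (s * (6%:R * sqrt7 * i)) <->
            exists2 F : tensor C 8 1, F \in Lambda C 8 1 &
              X = incl8 ((- s * (i / sqrt7)) *: et_Theta F)
                  + (wedge (incl8 F) (incl2 (epsilon C)) :
                       tensor C (8 + 2) 3)) /\
         \dim (E (s * (6%:R * sqrt7 * i))) = 8%N)].

Proof.
split; [split | split].
- by case=> -[x1 x2] x3 _; apply: assemble_form.
- move=> F FL; have [x xP xF] := assemble_surj FL; exists x; split=> // y [yP yF].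
  by apply: assemble_inj => //; rewrite xF yF.
- by move=> x xP; split; [apply: block_operator_in_summands | apply: b_Theta_hat_assemble].
move=> C i sqrt7 E L2 L3 R_.
have ii : i * i = -1 :> R[i] by rewrite -expr2; apply: sqr_i.
have rr : sqrt7 * sqrt7 = 7 :> R[i].
  by rewrite -rmorphM /= -expr2 sqr_sqrtr // rmorph_nat.
split.
- exact: spectrum ii rr.
- by split; [apply: eigenspace_0 | apply: dim_eigenspace_0].
- exact: eigenspace_18 ii.
- exact: eigenspace_6 ii.
exact: eigenspace_6_sqrt7 ii rr.
Qed.
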